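(* Let $\Omega\subset\mathbb{R}^N$ be a nonempty open bounded connected set with $\mathcal{L}^N(\Omega)=1$, $X=\overline{\Omega}$, $Y\subset\mathbb{R}^N$ open with $\mathcal{L}^N(Y)=1$, $\mu=\mathcal{L}^N\llcorner\Omega$, $\nu=\mathcal{L}^N\llcorner Y$, $H,K:X\to(0,+\infty)$ in $L^1(X,\mu)$ and $\mathcal{A}$ a family of balls covering $X$. Let $u\in\mathrm{Refo}(\mu;\nu)^{H,K}$ be incompressible, i.e. $|Ju(x)|=1$ for a.e. $x\in\Omega$, where $Ju=\det\nabla u$. Then $u|_\Omega$ is globally invertible (injective).
   Context: For $u:X\to Y$, $x_0\in X$: $e_u(x_0)=\limsup_{x\to x_0,\,x\ne x_0}\frac{|u(x)-u(x_0)|}{|x-x_0|}$, $c_u(x_0)=\limsup_{x\to x_0,\,x\ne x_0}\frac{|x-x_0|}{|u(x)-u(x_0)|}$ (quotient $+\infty$ if $u(x)=u(x_0)$). $\mathrm{Refo}(\mu;\nu)^{H,K}$ is the set of maps $u:X\to Y$ with $u_\#\mu=\nu$ (i.e. $\mu(u^{-1}(A))=\nu(A)$ for Borel $A$) such that for every $x\in X$ there is $B(x,r)\in\mathcal{A}$ with $c_u(y)\le H(x)$, $e_u(y)\le K(x)$ for all $y\in\overline{B}(x,r)\cap\Omega$. (Such $u$ are locally Lipschitz on $\Omega$, hence a.e. differentiable.) *)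

(* Defs.v *)
From HB Require Import structures.
From mathcomp Require Import all_boot all_order all_algebra.
From mathcomp Require Import all_classical all_reals all_analysis.
Set Implicit Arguments. Unset Strict Implicit. Unset Printing Implicit Defensive.
Import Order.TTheory GRing.Theory Num.Theory.
Import numFieldNormedType.Exports.
Local Open Scope classical_set_scope.
Local Open Scope ring_scope.

Section Defs.
Context {R : realType} {N : nat}.
Local Notation V := 'rV[R]_N.

Definition eucl (v : V) : R := Num.sqrt (\sum_(i < N) (v ord0 i) ^+ 2).

Definition eball (x : V) (r : R) : set V := [set y | eucl (y - x) < r].
Definition ecball (x : V) (r : R) : set V := [set y | eucl (y - x) <= r].

Definition box (a b : V) : set V := [set x | forall i, a ord0 i <= x ord0 i < b ord0 i].
Definition boxvol (a b : V) : R := \prod_(i < N) (b ord0 i - a ord0 i).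
Definition lebN (A : set V) : \bar R :=
  ereal_inf [set s | exists (a b : nat -> V),
               (forall k i, a k ord0 i <= b k ord0 i) /\
               A `<=` \bigcup_k box (a k) (b k) /\
               s = (\sum_(k <oo) (boxvol (a k) (b k))%:E)%E].

Definition leb_measurable (E : set V) : Prop :=
  forall A, lebN A = (lebN (A `&` E) + lebN (A `&` ~` E))%E.

Definition borel (A : set V) : Prop := <<s [set O : set V | open O] >> A.

Definition pushforward_leb (Omega Y : set V) (u : V -> V) : Prop :=
  forall A, borel A -> lebN (Omega `&` (u @^-1` A)) = lebN (Y `&` A).

(* H in L^1(X, mu), mu = L^N restricted to Omega, for H >= 0 on X:
   H is mu-measurable and (layer-cake formula)
   \int H dmu = \int_0^oo mu({H > t}) dt < +oo *)
Definition L1_mu (Omega : set V) (H : V -> R) : Prop :=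
  (forall t : R, leb_measurable (Omega `&` [set x | t < H x])) /\
  (\int[@lebesgue_measure R]_(t in `[0%R, +oo[%classic)
      lebN (Omega `&` [set x | (t < H x)%R]) < +oo)%E.

Definition limsup_punct (D : set V) (x0 : V) (q : V -> \bar R) : \bar R :=
  ereal_inf [set ereal_sup (q @` [set x | D x /\ 0 < eucl (x - x0) < d])
            | d in [set d : R | 0 < d]].

Definition e_u (X : set V) (u : V -> V) (x0 : V) : \bar R :=
  limsup_punct X x0 (fun x => (eucl (u x - u x0) / eucl (x - x0))%:E).
Definition c_u (X : set V) (u : V -> V) (x0 : V) : \bar R :=
  limsup_punct X x0 (fun x => if u x == u x0 then +oo%E
                              else (eucl (x - x0) / eucl (u x - u x0))%:E).

Definition ball_family_covering (A : set (set V)) (X : set V) : Prop :=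
  (forall B, A B -> exists c r, 0 < r /\ B = eball c r) /\
  X `<=` \bigcup_(B in A) B.

Definition Refo (Omega Y : set V) (A : set (set V)) (H K : V -> R)
    (u : V -> V) : Prop :=
  let X := closure Omega in
  (forall x, X x -> Y (u x)) /\
  pushforward_leb Omega Y u /\
  (forall x, X x -> exists r : R, 0 < r /\ A (eball x r) /\
     forall y, ecball x r y -> Omega y ->
       (c_u X u y <= (H x)%:E)%E /\ (e_u X u y <= (K x)%:E)%E).

Definition incompressible (Omega : set V) (u : V -> V) : Prop :=
  lebN [set x | Omega x /\
        ~ (differentiable u x /\ `|\det (lin1_mx ('d u x))| = 1)] = 0%E.

End Defs.

(* Main.v *)
(* Suppose u a = u b with a <> b.  By |Ju| = 1, u does not increase Lebesgue
   measure locally, while the transport identity counts the preimages of a set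
   with multiplicity; hence images of separated compact sets overlap in a null
   set only, and almost every point has no twin.  Since c_u is finite, u a is not
   attained on a small sphere about a; near a there is a point x0 without twin in
   the ball at which u is differentiable with an invertible derivative, so the
   degree of u at u x0 is nonzero, and u maps the ball onto a neighbourhood of
   u a.  The same holds at b, and the two images overlap in a set of positive
   measure.

   Instead of degree theory, a missed value is used to extend u to the whole
   space with x0 as only preimage of u x0; an inversion about x0 then contradicts
   the Poincare-Miranda theorem, which comes from a mod 2 discrete Stokes
   argument on a cubical grid.  Volume estimates are localized by bisection of
   boxes (Cousin's lemma). *)
Require Import Defs.
From HB Require Import structures.
From mathcomp Require Import all_boot all_order all_algebra all_fingroup.
From mathcomp Require Import all_classical all_reals all_analysis.
From mathcomp Require Import zify ring lra.
Set Implicit Arguments. Unset Strict Implicit. Unset Printing Implicit Defensive.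
Import Order.TTheory GRing.Theory Num.Theory.
Import numFieldNormedType.Exports.
Local Open Scope classical_set_scope.
Local Open Scope ring_scope.

(** No Caratheodory measurability is established for [lebN]: sets are compared by countable
    subadditivity and by superadditivity across a coordinate hyperplane. Hence the compact sets
    whose images are compared are separated by such a hyperplane. Rational positions leave countably
    many pairs, enough to catch any two distinct points. Compactness makes the images closed, hence
    Borel, as the transport identity requires.

    The sign of [Ju] is unknown and may vary, so preimages cannot be counted with a signed degree. A
    single twinless preimage with invertible derivative has local degree 1 or -1, which is odd;
    working mod 2 loses nothing and avoids orientations.

    A null set of bad points contributes little to the volume of an image because one Lipschitz
    constant serves a whole ball: [K] is evaluated at the centre of the ball, not at the current
    point. The bound on [c_u] is used only at the two points with a common image.

    The norm on row vectors is the max norm, whose balls are cubes, while [e_u] and [c_u] are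
    Euclidean; the comparison costs a factor [n.+1]. *)

(** * Cubical Kuhn lemma *)

Section Kuhn.
Variables (n m : nat).
Local Notation point := ('I_n.+1 -> nat).
Local Notation cube := {ffun 'I_n.+1 -> 'I_m.+1}.
Implicit Types (q : cube) (s : 'S_n.+1) (f : 'I_n.+1 -> point -> 'F_2).

(** Vertices of a simplex of the Freudenthal triangulation: inside the unit cube with lowest corner
    [q], coordinate [i] is raised along edge number [s i]. *)
Definition kuhn_vertex q s (t : nat) : point := fun i => (q i + (s i < t))%N.

(** The cup product of the coboundaries of all [f k], summed over all simplices: modulo 2 it counts
    the simplices in which, for every [k], the label [f k] changes along edge [k]. *)
Definition kuhn_sum f : 'F_2 :=
  \sum_s \sum_q \prod_k (f k (kuhn_vertex q s k.+1) - f k (kuhn_vertex q s k)).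

(* Evaluation, on the face opposite to the vertex [t], of the cochain obtained
   from the cup product of the coboundaries by replacing the [j]-th one by the
   value of [f j] at the vertex [c]. *)
Definition face_term f (j : 'I_n.+1) (t c : nat) q s : 'F_2 :=
  f j (kuhn_vertex q s c) *
  \prod_(k < n) (f (lift j k) (kuhn_vertex q s (k + (t <= k)).+1)
                 - f (lift j k) (kuhn_vertex q s (k + (t <= k)))).

Lemma addrr_F2 (x : 'F_2) : x + x = 0.
Proof. exact: (@addrr_pchar2 _ (pchar_Fp (isT : prime 2))). Qed.

Lemma eq_addr_F2 (x y : 'F_2) : x + y = 0 -> x = y.
Proof. by move=> h; rewrite -[x]addr0 -(addrr_F2 y) addrA h add0r. Qed.

(** Only factor [j] is split into its two end values; the other factors keep their edges, which
    leaves a gap at the edge from [j] to [j.+1]. *)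
Lemma kuhn_sumE f j :
  kuhn_sum f = \sum_s \sum_q face_term f j j j.+1 q s
             - \sum_s \sum_q face_term f j j j q s.
Proof.
rewrite /kuhn_sum -sumrB; apply: eq_bigr => s _; rewrite -sumrB.
apply: eq_bigr => q _; rewrite (bigD1_ord j) //= mulrBl /face_term.
have H (k : 'I_n) : bump j k = (k + (j <= k))%N by rewrite /bump addnC.
by congr (_ * _ - _ * _); apply: eq_bigr => k _; rewrite H.
Qed.

Lemma kuhn_vertex_tperm q s (a b : 'I_n.+1) (r : nat) :
  b = a.+1 :> nat -> r != a.+1 ->
  kuhn_vertex q (s * tperm a b)%g r = kuhn_vertex q s r.
Proof.
move=> hb hr; apply: funext => i; rewrite /kuhn_vertex permM; congr (_ + _)%N.
by case: tpermP => [->|->|//]; rewrite ?hb; congr nat_of_bool; lia.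
Qed.

(* An interior face belongs to two simplices, exchanged by a transposition. *)
Lemma sum_swap (X : cube -> 'S_n.+1 -> 'F_2) (a b : 'I_n.+1) : a != b ->
  (forall q s, X q (s * tperm a b)%g = X q s) -> \sum_s \sum_q X q s = 0.
Proof.
move=> ab hX; rewrite (bigID (fun s : 'S_n.+1 => odd_perm s)) /=.
rewrite (reindex_inj (mulIg (tperm a b))) /=.
rewrite [X in X + _](_ : _ = \sum_(s : 'S_n.+1 | ~~ odd_perm s) \sum_q X q s) ?addrr_F2 //.
apply: eq_big => [s|s _]; last by apply: eq_bigr => q _.
by rewrite odd_permM odd_tperm ab addbT.
Qed.

(** Moves the gap up by one edge. Modulo 2 the two products add up to one in which the factor [k0]
    telescopes to the difference between vertices [t] and [t.+2]. As [c != t.+1], vertex [t.+1] has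
    disappeared, and it is the only one affected by exchanging the directions of edges [t] and
    [t.+1]. *)
Lemma face_term_step f j t c : (t < n)%N -> c != t.+1 ->
  \sum_s \sum_q face_term f j t c q s = \sum_s \sum_q face_term f j t.+1 c q s.
Proof.
move=> tn hc; apply: eq_addr_F2; rewrite -big_split /=.
under eq_bigr do rewrite -big_split /=.
pose k0 := Ordinal tn.
pose a : 'I_n.+1 := widen_ord (leqnSn n) k0; pose b : 'I_n.+1 := lift ord0 k0.
have hb : b = a.+1 :> nat by [].
pose X q s : 'F_2 := f j (kuhn_vertex q s c) *
  ((f (lift j k0) (kuhn_vertex q s t.+2) - f (lift j k0) (kuhn_vertex q s t)) *
  \prod_(k < n | k != k0) (f (lift j k) (kuhn_vertex q s (k + (t <= k)).+1)
                 - f (lift j k) (kuhn_vertex q s (k + (t <= k))))).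
have hX q s : face_term f j t c q s + face_term f j t.+1 c q s = X q s.
  rewrite /face_term /X (bigD1 k0) //= [in X in _ + X](bigD1 k0) //=.
  rewrite leqnn ltnn addn0 addn1.
  rewrite [X in _ + _ * (_ * X)](eq_bigr (fun k : 'I_n =>
    f (lift j k) (kuhn_vertex q s (k + (t <= k)).+1)
                 - f (lift j k) (kuhn_vertex q s (k + (t <= k))))); first by ring.
  move=> k; rewrite -val_eqE /= => kt.
  by have -> : (t < k)%N = (t <= k)%N by lia.
under eq_bigr do under eq_bigr do rewrite hX.
apply: (@sum_swap _ a b); first by rewrite -val_eqE /= /bump; lia.
have hv := kuhn_vertex_tperm _ _ hb.
move=> q s; rewrite /X !hv /=; [|lia..].
congr (_ * (_ * _)); apply: eq_bigr => k; rewrite -val_eqE /= => kt.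
by rewrite !hv //=; case: (leqP t k); lia.
Qed.

(** With the value of [f j] at [j.+1] the gap can move down, with the value at [j] it can move up;
    the excluded case of [face_term_step] blocks the other direction. At the extreme edge the
    product lives on a genuine face. *)
Lemma face_term_low f (j : 'I_n.+1) (t : nat) : (t <= j)%N ->
  \sum_s \sum_q face_term f j t j.+1 q s = \sum_s \sum_q face_term f j 0 j.+1 q s.
Proof.
elim: t => // t IH tj; rewrite -IH; last lia.
by symmetry; apply: face_term_step; have := ltn_ord j; lia.
Qed.

Lemma face_term_high f (j : 'I_n.+1) (d : nat) : (j + d <= n)%N ->
  \sum_s \sum_q face_term f j j j q s = \sum_s \sum_q face_term f j (j + d) j q s.
Proof.
elim: d => [|d IH] jd; first by rewrite addn0.
rewrite IH; last lia.
by rewrite addnS; apply: face_term_step; lia.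
Qed.

(** Moves the first edge of a simplex to the end; together with [shift_cube] this gives the simplex
    that starts at the second vertex of the old one. *)
Definition rot_perm : 'S_n.+1 := perm (@ord_pred_inj n.+1).

Definition shift_cube s q : cube :=
  [ffun i => if s i == ord0 then ordS (q i) else q i].

Lemma shift_cube_bij s : bijective (shift_cube s).
Proof.
exists (fun q => [ffun i => if s i == ord0 then ord_pred (q i) else q i] : cube).
  by move=> q; apply/ffunP => i; rewrite !ffunE; case: eqP => // _; rewrite ordSK.
by move=> q; apply/ffunP => i; rewrite !ffunE; case: eqP => // _; rewrite ord_predK.
Qed.

(* Opposite boundary faces are matched by a cyclic shift; the terms of the
   faces where the shift wraps around vanish. *)
Lemma face_term_shift f j q s :
  (forall k, k != j -> forall v : point, v k = 0%N -> f k v = 0) ->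
  (forall k, k != j -> forall v : point, v k = m.+1 -> f k v = 1) ->
  (forall v : point, v j = 0%N \/ v j = m.+1 -> f j v = 0) ->
  face_term f j 0 j.+1 q s
  = face_term f j n j (shift_cube s q) (s * rot_perm)%g.
Proof.
move=> f0 f1 fj; rewrite /face_term.
pose i0 : 'I_n.+1 := (s^-1)%g ord0.
have si0 : s i0 = ord0 by rewrite permKV.
have rot0 : rot_perm ord0 = n :> nat by rewrite permE /= modn_small.
have [qm|qm] := eqVneq (q i0 : nat) m; last first.
  have hv t : (t <= n)%N -> kuhn_vertex q s t.+1
     = kuhn_vertex (shift_cube s q) (s * rot_perm)%g t.
    move=> tn; apply: funext => i; rewrite /kuhn_vertex ffunE permM.
    have [si|si] := eqVneq (s i) ord0.
      have -> : i = i0 by rewrite /i0 -si permK.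
      rewrite si0 rot0 /= modn_small; last by have := ltn_ord (q i0); lia.
      lia.
    congr (_ + _)%N; congr nat_of_bool; rewrite permE /=.
    have := ltn_ord (s i); have : (s i : nat) != 0%N by [].
    move: (nat_of_ord (s i)) => a a0 an.
    have -> : (a + n.+1).-1 = (a.-1 + n.+1)%N by lia.
    by rewrite modnDr modn_small; lia.
  rewrite hv; last by have := ltn_ord j; lia.
  congr (_ * _); apply: eq_bigr => k _; have kn := ltn_ord k.
  by rewrite leq0n leqNgt kn /= addn1 addn0 !hv //; lia.
(* Wrap-around case: the face on the left has coordinate [i0] equal to [m.+1], the one on the right
   has it equal to 0. If [i0] is not [j], the label [f i0] is constant on each face and its
   difference vanishes; if it is [j], the value of [f j] vanishes. *)
have hv1 t : (0 < t)%N -> kuhn_vertex q s t i0 = m.+1.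
  by move=> t0; rewrite /kuhn_vertex qm si0 t0 addn1.
have hv2 t : (t <= n)%N -> kuhn_vertex (shift_cube s q) (s * rot_perm)%g t i0 = 0%N.
  by move=> t0; rewrite /kuhn_vertex ffunE permM si0 eqxx rot0 /= qm modnn; lia.
case: (unliftP j i0) => [k hk|hj].
  have kn := ltn_ord k.
  have kj : lift j k != j by rewrite eq_sym neq_lift.
  rewrite (bigD1 k) //= [in RHS](bigD1 k) //= leqNgt kn /= addn0 addn1.
  have e1 t : (0 < t)%N -> f (lift j k) (kuhn_vertex q s t) = 1.
    by move=> t0; apply: f1 => //; rewrite -hk hv1.
  have e0 t : (t <= n)%N ->
      f (lift j k) (kuhn_vertex (shift_cube s q) (s * rot_perm)%g t) = 0.
    by move=> tn; apply: f0 => //; rewrite -hk hv2.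
  by rewrite !e1 // !e0 ?(ltnW kn) // !subrr !mul0r !mulr0.
rewrite !fj ?mul0r //; first by left; rewrite -hj hv2 // -ltnS.
by right; rewrite -hj hv1.
Qed.

(** Once the gaps have been moved, two sums remain, over the faces opposite the first and the last
    vertex; the cyclic shift is a bijection matching them term by term. *)
Lemma kuhn_sum_vanish f j :
  (forall k, k != j -> forall v : point, v k = 0%N -> f k v = 0) ->
  (forall k, k != j -> forall v : point, v k = m.+1 -> f k v = 1) ->
  (forall v : point, v j = 0%N \/ v j = m.+1 -> f j v = 0) ->
  kuhn_sum f = 0.
Proof.
move=> f0 f1 fj; rewrite (kuhn_sumE f j) face_term_low //.
have jn : (j + (n - j) = n)%N by have := ltn_ord j; lia.
rewrite (@face_term_high f j (n - j)) ?jn //.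
apply/eqP; rewrite subr_eq0; apply/eqP.
rewrite [RHS](reindex_inj (mulIg rot_perm)) /=; apply: eq_bigr => s _.
rewrite [RHS](reindex (shift_cube s)) /=; last exact: onW_bij (shift_cube_bij s).
by apply: eq_bigr => q _; exact: face_term_shift.
Qed.

Definition top_label (k : 'I_n.+1) (v : point) : 'F_2 := (v k == m.+1)%:R.

(** Along edge [k] the label [top_label k] changes only if [q k = m] and [s k = k]; exactly one
    simplex satisfies this for all [k]. *)
Lemma kuhn_sum_top : kuhn_sum top_label = 1.
Proof.
have fac q s (k : 'I_n.+1) : ~~ ((q k == ord_max) && (s k == k)) ->
    top_label k (kuhn_vertex q s k.+1) - top_label k (kuhn_vertex q s k) = 0.
  rewrite /top_label /kuhn_vertex -!val_eqE /=; have := ltn_ord (q k).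
  move: (nat_of_ord (q k)) (nat_of_ord (s k)) (nat_of_ord k) => a b c am h.
  have -> : (a + (b < c.+1) == m.+1)%N = (a + (b < c) == m.+1)%N by lia.
  exact: subrr.
pose qm : cube := [ffun => ord_max].
rewrite /kuhn_sum (bigD1 1%g) //= (bigD1 qm) //= [X in _ + X + _]big1; last first.
  move=> q /eqP nq; have /existsP[k hk] : [exists k, q k != ord_max].
    apply: contra_notT nq => /existsPn h; apply/ffunP => k.
    by rewrite ffunE; apply/eqP; rewrite -[_ == _]negbK.
  by rewrite (bigD1 k) //= fac ?mul0r // (negbTE hk).
rewrite [X in _ + X]big1; last first.
  move=> s /eqP ns; rewrite big1 // => q _.
  have /existsP[k hk] : [exists k, s k != k].
    apply: contra_notT ns => /existsPn h; apply/permP => k.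
    by rewrite perm1; apply/eqP; rewrite -[_ == _]negbK.
  by rewrite (bigD1 k) //= fac ?mul0r // (negbTE hk) andbF.
rewrite !addr0 big1 // => k _.
by rewrite /top_label /kuhn_vertex ffunE perm1 /= ltnSn ltnn addn1 addn0 eqxx ltn_eqF // subr0.
Qed.

(** The labels are replaced by [top_label] one at a time. The sum is linear in each label, and the
    difference of the old and the new label vanishes on both faces orthogonal to its direction, so
    [kuhn_sum_vanish] applies. *)
Lemma kuhn_sum_const f :
  (forall k (v : point), v k = 0%N -> f k v = 0) ->
  (forall k (v : point), v k = m.+1 -> f k v = 1) ->
  kuhn_sum f = 1.
Proof.
move=> f0 f1; pose g (j : nat) (k : 'I_n.+1) := if (k < j)%N then top_label k else f k.
have t0 k (v : point) : v k = 0%N -> top_label k v = 0 by rewrite /top_label => ->.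
have t1 k (v : point) : v k = m.+1 -> top_label k v = 1.
  by rewrite /top_label => ->; rewrite eqxx.
have step (j : nat) : (j <= n.+1)%N -> kuhn_sum (g j) = kuhn_sum f.
  elim: j => [//|j IH jn]; rewrite -IH ?(ltnW jn) //.
  pose J := Ordinal jn.
  pose h k v := if k == J then top_label k v - f k v else g j k v.
  have gh k : k != J -> (g j.+1 k = g j k) /\ (h k = g j k).
    move=> kJ; rewrite /h (negbTE kJ); split=> //; rewrite /g ltnS leq_eqVlt.
    by rewrite -val_eqE /= in kJ; rewrite (negbTE kJ).
  have gJ : g j.+1 J = top_label J by rewrite /g /= ltnSn.
  have gJ' : g j J = f J by rewrite /g /= ltnn.
  have hJ v : h J v = top_label J v - f J v by rewrite /h eqxx.
  have : kuhn_sum (g j.+1) - kuhn_sum (g j) = kuhn_sum h.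
    rewrite /kuhn_sum -sumrB; apply: eq_bigr => s _; rewrite -sumrB.
    apply: eq_bigr => q _; rewrite !(bigD1_ord J) //= gJ gJ' !hJ.
    have e k : lift J k != J by rewrite eq_sym neq_lift.
    rewrite (eq_bigr (fun k => g j (lift J k) (kuhn_vertex q s (lift J k).+1)
       - g j (lift J k) (kuhn_vertex q s (lift J k)))); last first.
      by move=> k _; rewrite (gh _ (e k)).1.
    rewrite [in RHS](eq_bigr (fun k => g j (lift J k) (kuhn_vertex q s (lift J k).+1)
       - g j (lift J k) (kuhn_vertex q s (lift J k)))); last first.
      by move=> k _; rewrite (gh _ (e k)).2.
    ring.
  rewrite (@kuhn_sum_vanish h J) => [/eqP|k kJ v vk|k kJ v vk|v].
  - by rewrite subr_eq0 => /eqP.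
  - by rewrite (gh _ kJ).2 /g; case: ifP => _; [exact: t0|exact: f0].
  - by rewrite (gh _ kJ).2 /g; case: ifP => _; [exact: t1|exact: f1].
  - by rewrite hJ; case=> vJ; [rewrite t0 // f0 // subrr|rewrite t1 // f1 // subrr].
rewrite -(step n.+1) // -kuhn_sum_top; congr kuhn_sum.
by apply: funext => k; rewrite /g ltn_ord.
Qed.

Lemma kuhn_cube (l : 'I_n.+1 -> point -> bool) :
  (forall k (v : point), v k = 0%N -> ~~ l k v) ->
  (forall k (v : point), v k = m.+1 -> l k v) ->
  exists q : cube, forall k, exists r s : point,
    [/\ forall i, (q i <= r i <= (q i).+1)%N,
        forall i, (q i <= s i <= (q i).+1)%N, l k r & ~~ l k s].
Proof.
move=> l0 l1; pose f k v : 'F_2 := (l k v)%:R.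
have h1 : kuhn_sum f = 1.
  apply: kuhn_sum_const => k v hv; rewrite /f; first by rewrite (negbTE (l0 _ _ hv)).
  by rewrite l1.
have hex : exists s q, \prod_k (f k (kuhn_vertex q s k.+1) - f k (kuhn_vertex q s k)) != 0.
  apply/not_existsP => h; move: h1; rewrite /kuhn_sum big1 => [/eqP|s _].
    by rewrite eq_sym oner_eq0.
  rewrite big1 // => q _; apply/eqP; rewrite -[_ == _]negbK; apply/negP => hq.
  by apply: (h s); exists q.
have [s [q /prodf_neq0 hq]] := hex; exists q => k.
have vb t i : (q i <= kuhn_vertex q s t i <= (q i).+1)%N by rewrite /kuhn_vertex; lia.
have := hq k isT; rewrite /f; case E1: (l k _); case E2: (l k _); rewrite ?subrr ?eqxx // => _.
  by exists (kuhn_vertex q s k.+1), (kuhn_vertex q s k); rewrite E1 E2.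
by exists (kuhn_vertex q s k), (kuhn_vertex q s k.+1); rewrite E1 E2.
Qed.

End Kuhn.

(** * The Poincare-Miranda theorem *)

Lemma continuous_dist (R : realType) (V : normedModType R) (x : V) :
  continuous (fun y : V => `|y - x|).
Proof. by move=> y; apply: cvg_norm; apply: cvgB; [exact: cvg_id|exact: cvg_cst]. Qed.

Section RowVectors.
Context {R : realType} {n : nat}.
Implicit Types (x y : 'rV[R]_n) (c : R).

Lemma ler_coord_norm y i : `|y ord0 i| <= `|y|.
Proof.
rewrite [`|y|]mx_normrE; exact: (le_bigmax _ (fun ij => `|y ij.1 ij.2|) (ord0, i)).
Qed.

Lemma rV_norm_le y c : 0 <= c -> (forall i, `|y ord0 i| <= c) -> `|y| <= c.
Proof.
move=> c0 h; rewrite [`|y|]mx_normrE; apply: bigmax_le => // -[a b] _ /=.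
by rewrite (ord1 a).
Qed.

Lemma rV_norm_attained y : 0 < `|y| -> exists i, `|y ord0 i| = `|y|.
Proof.
move=> y0; have [|[a b] /= h] := @mx_norm_neq0 _ _ _ y; first by rewrite gt_eqF.
by exists b; rewrite [RHS]h (ord1 a).
Qed.

Lemma nbhs_norm x (P : set 'rV[R]_n) :
  nbhs x P -> exists2 d : R, 0 < d & forall y, `|y - x| < d -> P y.
Proof.
move=> /nbhs_ballP[d /= d0 h]; exists d => // y yx; apply: h.
by rewrite -ball_normE /ball_ /= distrC.
Qed.

Lemma norm_nbhs x (P : set 'rV[R]_n) (d : R) :
  0 < d -> (forall y, `|y - x| < d -> P y) -> nbhs x P.
Proof.
move=> d0 h; apply/nbhs_ballP; exists d => // y.
by rewrite -ball_normE /ball_ /= distrC; exact: h.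
Qed.

Lemma closed_cube_compact x c : compact [set y : 'rV[R]_n | `|y - x| <= c].
Proof.
apply: bounded_closed_compact.
  exists (`|x| + c); split; first exact: num_real.
  move=> M xM y /= yx; apply: ltW; apply: le_lt_trans xM.
  by rewrite -[y](subrK x); apply: le_trans (ler_normD _ _) _; rewrite addrC lerD2l.
have h : continuous (fun y : 'rV[R]_n => `|y - x|) by exact: continuous_dist.
by apply: (@preimage_closed _ _ _ [set z : R | z <= c]) => [y _|]; [exact: h|exact: closed_le].
Qed.

End RowVectors.

Lemma poincare_miranda (R : realType) (n : nat) (F : 'rV[R]_n.+1 -> 'rV[R]_n.+1)
    (r : R) : 0 < r -> continuous F ->
  (forall (y : 'rV[R]_n.+1) i, `|y| <= r -> y ord0 i = - r -> F y ord0 i <= 0) ->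
  (forall (y : 'rV[R]_n.+1) i, `|y| <= r -> y ord0 i = r -> 0 <= F y ord0 i) ->
  exists2 y, `|y| <= r & F y = 0.
Proof.
move=> r0 cF Fneg Fpos.
have grid (m : nat) : exists y : 'rV[R]_n.+1, `|y| <= r /\ forall k, exists a b : 'rV[R]_n.+1,
    [/\ `|a - y| <= 2 * r / m.+1%:R, `|b - y| <= 2 * r / m.+1%:R,
       0 <= F a ord0 k & F b ord0 k <= 0].
  pose e : R := 2 * r / m.+1%:R.
  have e0 : 0 < e by rewrite divr_gt0 // mulr_gt0.
  have em : m.+1%:R * e = 2 * r by rewrite mulrC divfK.
  pose pt (v : 'I_n.+1 -> nat) : 'rV[R]_n.+1 := \row_i (- r + (v i)%:R * e).
  have pt_le v : (forall i, (v i <= m.+1)%N) -> `|pt v| <= r.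
    move=> vm; apply: rV_norm_le => [|i]; first exact: ltW.
    have h1 : 0 <= (v i)%:R * e by rewrite mulr_ge0 // ltW.
    have h2 : (v i)%:R * e <= m.+1%:R * e by rewrite ler_pM2r // ler_nat.
    by rewrite mxE ler_norml; apply/andP; split; lra.
  (* On the two faces orthogonal to [k] the label is fixed without consulting [F], which may vanish
     there; the boundary hypotheses then supply the weak signs. *)
  pose l k v := (v k == m.+1) || ((v k != 0%N) && (0 < F (pt v) ord0 k)).
  have [||q hq] := @kuhn_cube n m l.
  - by move=> k v; rewrite /l => ->.
  - by move=> k v; rewrite /l => ->; rewrite eqxx.
  have qm i : (q i <= m)%N by rewrite -ltnS.
  exists (pt (fun i => q i)); split; first by apply: pt_le => i; apply: leqW.
  move=> k; have [a [b [ha hb la lb]]] := hq k; exists (pt a), (pt b).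
  have close v : (forall i, (q i <= v i <= (q i).+1)%N) ->
      `|pt v - pt (fun i => q i)| <= e.
    move=> hv; apply: rV_norm_le => [|i]; first exact: ltW.
    have /andP[h1 h2] := hv i; rewrite !mxE.
    have -> : - r + (v i)%:R * e - (- r + (q i)%:R * e) = (v i - q i)%:R * e.
      by rewrite natrB //; ring.
    rewrite normrM normr_nat gtr0_norm // -[leRHS]mul1r ler_pM2r //.
    by rewrite -[1]/(1%:R) ler_nat; lia.
  have inQ v : (forall i, (q i <= v i <= (q i).+1)%N) -> `|pt v| <= r.
    by move=> hv; apply: pt_le => i; have /andP[_] := hv i; have := qm i; lia.
  split; [exact: close|exact: close| |].
    have [/eqP am|/andP[_ /ltW //]] := orP la.
    by apply: Fpos; [exact: inQ|rewrite mxE am em; lra].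
  move: lb; rewrite /l negb_or negb_and negbK -leNgt => /andP[_ /orP[/eqP b0|//]].
  by apply: Fneg; [exact: inQ|rewrite mxE b0; lra].
have [y_ /all_and2[y_r y_g]] := choice grid.
have [p []] : [set y : 'rV[R]_n.+1 | `|y - 0| <= r] `&` cluster (y_ @ \oo) !=set0.
  apply: (@closed_cube_compact R n.+1 0 r).
  by exists 0%N => // k _ /=; rewrite subr0.
rewrite /= subr0 => pr clp; exists p => //; apply/eqP/negPn/negP => Fp0.
have e0 : 0 < `|F p| by rewrite normr_gt0.
have /cvgrPdist_lt /(_ _ e0) /nbhs_norm [d d0 hd] := cF p.
have d20 : 0 < d / 2 by rewrite divr_gt0.
have [M hM] : exists M : nat, forall m, (M <= m)%N -> 2 * r / m.+1%:R < d / 2.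
  exists (Num.truncn (4 * r / d)).+1 => m Mm.
  have h : 4 * r / d < m.+1%:R.
    apply: lt_le_trans (truncnS_gt _) _; rewrite ler_nat; exact: leqW.
  rewrite ltr_pdivrMr //; move: h; rewrite ltr_pdivrMr // => h; lra.
have [_ [[m Mm <-] pm]] : (y_ @` [set m | (M <= m)%N]) `&` ball p (d / 2) !=set0.
  apply: clp; last exact: nbhsx_ballx.
  by exists M => // m /= Mm; exists m.
move: pm; rewrite -ball_normE /ball_ /= distrC => pm.
have near a : `|a - y_ m| <= 2 * r / m.+1%:R -> `|F p - F a| < `|F p|.
  move=> ha; apply: hd.
  have -> : a - p = (a - y_ m) + (y_ m - p) by rewrite addrA subrK.
  by have h1 := le_lt_trans ha (hM m Mm); apply: le_lt_trans (ler_normD _ _) _; rewrite [ltRHS]splitr ltrD.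
(* In a coordinate where [F p] attains its norm, a deviation smaller than that norm cannot change
   the sign; yet [a] and [b] near [p] show both weak signs. *)
have [k hk] := rV_norm_attained e0.
have [a [b [ha hb Fa Fb]]] := y_g m k.
have := le_lt_trans (ler_coord_norm _ k) (near _ ha).
have := le_lt_trans (ler_coord_norm _ k) (near _ hb).
by rewrite !mxE -hk !ltr_norml; have [h|h] := ler0P (F p ord0 k); lra.
Qed.

(** * Nonzero degree at a simple preimage *)

Lemma lipschitz_continuous (R : realType) (V W : normedModType R) (f : V -> W) (C : R) :
  0 < C -> (forall x y, `|f x - f y| <= C * `|x - y|) -> continuous f.
Proof.
move=> C0 hf x; apply/cvgrPdist_lt => e e0; near=> z.
apply: le_lt_trans (hf _ _) _; rewrite mulrC -ltr_pdivlMr //; near: z.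
apply/nbhs_ballP; exists (e / C); rewrite /= ?divr_gt0 // => z.
by rewrite -ball_normE.
Unshelve. all: by end_near. Qed.

Section Unwinding.
Context {R : realType} {V : normedModType R}.

(* Outside the ball the map [u - q] is continued by running back along the rays
   to the centre, while its target slides from [q] to the omitted value [q']. *)
Lemma omitted_value_extension (u : V -> V) (a p q q' x0 : V) (r rho : R) :
  0 < r -> (forall x, `|x - a| <= r -> {for x, continuous u}) ->
  (forall x, `|x - a| = r -> rho <= `|u x - p|) ->
  `|q - p| < rho -> `|q' - p| < rho ->
  (forall x, `|x - a| <= r -> u x = q -> x = x0) ->
  (forall x, `|x - a| <= r -> u x <> q') ->
  exists U : V -> V, [/\ continuous U, forall x, U x = 0 -> x = x0,
    forall x, `|x - a| <= r -> U x = u x - q &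
    exists2 c, c != 0 & forall x, 3 * r <= `|x - a| -> U x = c].
Proof.
move=> r0 cu bd qrho q'rho uniq miss.
(* A point at distance [n] from [a] moves along its ray to distance [phi n * n], which is [n] up to
   [r], then [r] up to [2 * r], then [3 * r - n], and 0 from [3 * r] on. The target slides by [tau]
   only between [r] and [2 * r], while [g x] stays on the sphere. *)
pose phi (n : R) := Num.max 0 (Num.min (r / Num.max n r) (3 * r / Num.max n r - 1)).
pose tau (n : R) := Num.max 0 (Num.min 1 ((n - r) / r)).
pose g x := phi `|x - a| *: (x - a) + a.
pose U x := u (g x) - q - tau `|x - a| *: (q' - q).
have mx0 (n : R) : Num.max n r != 0.
  by rewrite gt_eqF // lt_max r0 orbT.
have phi1 n : n <= r -> phi n = 1.
  move=> nr; rewrite /phi (max_r nr) divff ?gt_eqF // -mulrA divff ?gt_eqF //.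
  rewrite min_l; last by lra.
  by rewrite max_r.
have phi_le n : r <= n -> 0 <= phi n * n <= r.
  move=> rn; have n0 : 0 < n by exact: lt_le_trans rn.
  rewrite mulr_ge0 ?le_max ?lexx ?(ltW n0) //= -ler_pdivlMr //.
  rewrite /phi (max_l rn) ge_max ge_min lexx /= andbT.
  by rewrite divr_ge0 // ltW.
have phi_eq n : r <= n -> n <= 2 * r -> phi n * n = r.
  move=> rn n2; have n0 : 0 < n by exact: lt_le_trans rn.
  rewrite /phi (max_l rn) min_l; last first.
    rewrite -subr_ge0 (_ : _ - _ = (2 * r - n) / n); first by apply: divr_ge0; [rewrite subr_ge0|exact: ltW].
    by field; rewrite gt_eqF.
  by rewrite max_r ?divfK ?gt_eqF // divr_ge0 // ltW.
have phi0 n : 3 * r <= n -> phi n = 0.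
  move=> n3; have rn : r <= n by lra.
  have n0 : 0 < n by exact: lt_le_trans rn.
  rewrite /phi (max_l rn) max_l // ge_min; apply/orP; right.
  by rewrite subr_le0 ler_pdivrMr // mul1r.
have tau01 n : 0 <= tau n <= 1.
  by rewrite /tau le_max lexx /= ge_max ler01 /= ge_min lexx.
have tau0 n : n <= r -> tau n = 0.
  move=> nr; rewrite /tau max_l // ge_min; apply/orP; right.
  by rewrite pmulr_lle0 ?invr_gt0 // subr_le0.
have tau1 n : 2 * r <= n -> tau n = 1.
  move=> nr; rewrite /tau min_l ?max_r //.
  by rewrite ler_pdivlMr // mul1r; lra.
have gE x : g x - a = phi `|x - a| *: (x - a) by rewrite /g addrK.
have gin x : `|x - a| <= r -> g x = x.
  by move=> xr; rewrite /g phi1 // scale1r subrK.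
have phi_ge0 n : 0 <= phi n by rewrite /phi le_max lexx.
have gN x : `|g x - a| = phi `|x - a| * `|x - a|.
  by rewrite gE normrZ ger0_norm.
have gr x : `|g x - a| <= r.
  have [xr|/ltW xr] := leP `|x - a| r; first by rewrite gin.
  by rewrite gN; have /andP[] := phi_le _ xr.
have ctau : continuous tau.
  move=> n; apply: (@continuous_max _ _ (cst 0) (fun n => Num.min 1 ((n - r) / r))).
    exact: cvg_cst.
  apply: (@continuous_min _ _ (cst 1) (fun n => (n - r) / r)); first exact: cvg_cst.
  apply: cvgM; last exact: cvg_cst.
  by apply: cvgB; [exact: cvg_id|exact: cvg_cst].
have cmx : continuous (fun n : R => (Num.max n r)^-1).
  move=> n; apply: cvgV => //.
  by apply: (@continuous_max _ _ id (cst r)); [exact: cvg_id|exact: cvg_cst].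
have cphi : continuous phi.
  move=> n; apply: (@continuous_max _ _ (cst 0)
    (fun n => Num.min (r / Num.max n r) (3 * r / Num.max n r - 1))).
    exact: cvg_cst.
  apply: (@continuous_min _ _ (fun n => r / Num.max n r) (fun n => 3 * r / Num.max n r - 1)).
    by apply: cvgM; [exact: cvg_cst|exact: cmx].
  apply: cvgB; last exact: cvg_cst.
  by apply: cvgM; [exact: cvg_cst|exact: cmx].
have cn (f : R -> R) : continuous f -> continuous (fun x : V => f `|x - a|).
  move=> cf x; apply: (@continuous_comp _ _ _ (fun y => `|y - a|) f).
    exact: continuous_dist.
  exact: cf.
have cg : continuous g.
  move=> x; apply: cvgD; last exact: cvg_cst.
  apply: cvgZ; first exact: cn.
  by apply: cvgB; [exact: cvg_id|exact: cvg_cst].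
exists U; split.
- move=> x; apply: cvgB.
    apply: cvgB; last exact: cvg_cst.
    by apply: (@continuous_comp _ _ _ g u); [exact: cg|exact: cu].
  by apply: cvgZ; [exact: cn|exact: cvg_cst].
- move=> x /eqP; rewrite /U subr_eq0 subr_eq => /eqP ux.
  have [xr|rx] := ltP `|x - a| r.
    move: ux; rewrite tau0 ?ltW // scale0r add0r gin ?ltW // => ux.
    by apply: uniq => //; exact: ltW.
  (* In this shell [g x] lies on the sphere, where [u] stays [rho] away from [p], whereas the moving
     target is a convex combination of [q] and [q'], both closer to [p]. *)
  have [x2|x2] := leP `|x - a| (2 * r).
    have := bd (g x); rewrite gN phi_eq // => /(_ erefl); rewrite leNgt ux.
    suff -> : `|tau `|x - a| *: (q' - q) + q - p| < rho by [].
    have /andP[t0 t1] := tau01 `|x - a|; move: (tau _) t0 t1 => t t0 t1.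
    have -> : t *: (q' - q) + q - p = t *: (q' - p) + (1 - t) *: (q - p).
      have -> : q' - q = (q' - p) - (q - p) by rewrite opprB addrA subrK.
      rewrite -addrA; move: (q - p) (q' - p) => B A.
      by rewrite scalerBr scalerBl scale1r -addrA [- _ + _]addrC.
    apply: le_lt_trans (ler_normD _ _) _; rewrite !normrZ !ger0_norm //; last by rewrite subr_ge0.
    have [->|t1'] := eqVneq t 1; first by rewrite subrr mul0r addr0 mul1r.
    have : 0 < 1 - t by rewrite subr_gt0 lt_neqAle t1' t1.
    by nra.
  case: (@miss (g x)) => //.
  by rewrite ux tau1 ?ltW // scale1r subrK.
- by move=> x xr; rewrite /U gin // tau0 // scale0r subr0.
- exists (u a - q'); last first.
    move=> x x3; rewrite /U /g phi0 // scale0r add0r tau1; last by lra.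
    by rewrite scale1r opprB addrA subrK.
  by rewrite subr_eq0; apply/eqP; apply: miss; rewrite subrr normr0 ltW.
Qed.

(** The inversion sends a punctured neighbourhood of 0 beyond distance [M] from [x0], so near 0 the
    map is constant. *)
Lemma inverted_map_continuous (U : V -> V) (x0 c : V) (M : R) :
  continuous U -> (forall x, M <= `|x - x0| -> U x = c) ->
  continuous (fun y => if y == 0 then c else U (`|y| ^- 2 *: y + x0)).
Proof.
move=> cU Uc; set W := (fun y => _).
have WE y : y != 0 -> W y = U (`|y| ^- 2 *: y + x0) by rewrite /W => /negbTE ->.
move=> y; have [->|y0] := eqVneq y 0.
  have m0 : 0 < (`|M| + 1)^-1 :> R by rewrite invr_gt0 ltr_wpDl.
  have Wc z : `|z| < (`|M| + 1)^-1 -> W z = c.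
    move=> zM; rewrite /W; case: eqP => // /eqP z0.
    rewrite Uc // addrK normrZ normfV normrX normr_id expr2 invfM divfK ?normr_eq0 //.
    have h : `|M| + 1 < `|z|^-1.
      by rewrite -[ltLHS]invrK ltf_pV2 // posrE ?normr_gt0.
    by have := ler_norm M; lra.
  rewrite /continuous_at Wc ?normr0 //.
  apply: cvg_near_cst; apply/nbhs_ballP; exists (`|M| + 1)^-1 => // z.
  by rewrite -ball_normE /ball_ /= sub0r normrN => /Wc ->.
rewrite /continuous_at WE //.
have hn : (\near y, y != 0 :> V).
  near=> z; rewrite -normr_gt0.
  have : `|y - z| < `|y|.
    near: z; apply/nbhs_ballP; exists `|y|; rewrite /= ?normr_gt0 // => z.
    by rewrite -ball_normE.
  by have := ler_normD (y - z) z; rewrite subrK => h1 h2; lra.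
have -> : W z @[z --> y] --> U (`|y| ^- 2 *: y + x0) <->
    U (`|z| ^- 2 *: z + x0) @[z --> y] --> U (`|y| ^- 2 *: y + x0).
  split => h; apply: cvg_trans h; apply: near_eq_cvg.
    by near=> z; rewrite WE //; near: z.
  by near=> z; rewrite WE //; near: z.
apply: (@continuous_comp _ _ _ (fun z => `|z| ^- 2 *: z + x0) U); last exact: cU.
apply: cvgD; last exact: cvg_cst.
apply: cvgZ; last exact: cvg_id.
apply: cvgV; first by rewrite sqrf_eq0 normr_eq0.
by apply: cvgM; apply: cvg_norm; exact: cvg_id.
Unshelve. all: by end_near. Qed.

End Unwinding.

Lemma mulmx_bounded (R : realType) (n : nat) (A : 'M[R]_n) :
  exists2 C : R, 0 < C & forall v : 'rV[R]_n, `|v *m A| <= C * `|v|.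
Proof.
exists (1 + \sum_i \sum_j `|A i j|).
  by rewrite ltr_wpDr // sumr_ge0 // => i _; rewrite sumr_ge0.
move=> v; apply: rV_norm_le => [|j].
  by rewrite mulr_ge0 // addr_ge0 // sumr_ge0 // => i _; rewrite sumr_ge0.
rewrite mxE; apply: le_trans (ler_norm_sum _ _ _) _.
rewrite mulrDl mul1r mulr_suml -[leLHS]add0r lerD //; apply: ler_sum => i _.
rewrite normrM mulrC ler_pM // ?ler_coord_norm //.
by rewrite (bigD1 j) //= lerDl sumr_ge0.
Qed.

(* The inversion [y |-> y / |y|^2] about the simple zero [x0] turns [U] into a
   continuous field pointing outwards on a cube, with value [c] at the centre. *)
Lemma simple_zero_not_unique (R : realType) (n : nat)
    (U : 'rV[R]_n.+1 -> 'rV[R]_n.+1) (x0 c : 'rV[R]_n.+1) (L : 'M[R]_n.+1) (M : R) :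
  continuous U -> (forall x, M <= `|x - x0| -> U x = c) -> c != 0 ->
  L \in unitmx ->
  (forall e : R, 0 < e -> exists2 d : R, 0 < d &
     forall h, `|h| < d -> `|U (h + x0) - h *m L| <= e * `|h|) ->
  exists2 x, x != x0 & U x = 0.
Proof.
move=> cU Uc c0 uL dU.
pose W (y : 'rV[R]_n.+1) := if y == 0 then c else U (`|y| ^- 2 *: y + x0).
have cW : continuous W by exact: inverted_map_continuous cU Uc.
pose F y := W y *m invmx L.
have [C C0 hC] := mulmx_bounded (invmx L).
have cF : continuous F.
  move=> y; apply: (@continuous_comp _ _ _ W (fun v => v *m invmx L)); first exact: cW.
  apply: (lipschitz_continuous C0) => v w.
  by rewrite -mulmxBl; exact: hC.
have C2 : 0 < (2 * C)^-1 by rewrite invr_gt0 mulr_gt0.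
have [d d0 hd] := dU _ C2.
have [r r0 dr] : exists2 r : R, 0 < r & d^-1 < r.
  by exists (d^-1 + 1); rewrite ?ltrDl // addr_gt0 // invr_gt0.
(* The inverted point is at distance [r^-1 < d] from [x0], where [U] is linear up to the factor
   [(2 * C)^-1]. After [invmx L] the error is at most [r^-1 / 2], too small to change the sign of a
   coordinate of [r ^- 2 *: y] of size [r^-1]. *)
have Fr y : `|y| = r -> `|F y - r ^- 2 *: y| <= r^-1 / 2.
  move=> yr; have y0 : y != 0 by rewrite -normr_gt0 yr.
  have hN : `|r ^- 2 *: y| = r^-1.
    by rewrite normrZ yr ger0_norm ?invr_ge0 ?exprn_ge0 ?ltW // expr2 invfM divfK ?gt_eqF.
  have := hd (r ^- 2 *: y); rewrite hN => /(_ _)/wrap[].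
    by rewrite invf_plt ?posrE.
  move=> h; rewrite /F /W (negbTE y0) yr.
  rewrite -[X in _ - X](mulmxK uL) -mulmxBl; apply: le_trans (hC _) _.
  apply: le_trans (ler_wpM2l (ltW C0) h) _.
  by rewrite mulrA invfM mulrCA mulfV ?gt_eqF // mulr1 mulrC.
have sgn (y : 'rV[R]_n.+1) i : `|y| <= r -> `|y ord0 i| = r -> `|F y ord0 i - r ^- 2 * y ord0 i| <= r^-1 / 2.
  move=> yr yi; have yr' : `|y| = r by apply/eqP; rewrite eq_le yr -yi ler_coord_norm.
  have := le_trans (ler_coord_norm _ i) (Fr _ yr'); by rewrite !mxE.
have rr : r ^- 2 * r = r^-1 by rewrite expr2 invfM divfK ?gt_eqF.
have rV0 : 0 < r^-1 by rewrite invr_gt0.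
have [||y yr Fy] := poincare_miranda r0 cF.
- move=> y i yr yi; have := sgn y i yr; rewrite yi normrN (ger0_norm (ltW r0)) => /(_ erefl).
  by rewrite mulrN rr ler_norml => /andP[_]; lra.
- move=> y i yr yi; have := sgn y i yr; rewrite yi (ger0_norm (ltW r0)) => /(_ erefl).
  by rewrite rr ler_norml => /andP[+ _]; lra.
have Wy : W y = 0 by rewrite -[W y](mulmxKV uL) -/(F y) Fy mul0mx.
move: Wy; rewrite /W; case: eqP => [_ /eqP|/eqP y0 Uy]; first by rewrite (negbTE c0).
exists (`|y| ^- 2 *: y + x0) => //.
by rewrite -subr_eq0 addrK scaler_eq0 invr_eq0 sqrf_eq0 normr_eq0 orbb.
Qed.

Lemma image_covers_ball (R : realType) (n : nat)
    (u : 'rV[R]_n.+1 -> 'rV[R]_n.+1) (a p x0 : 'rV[R]_n.+1) (r rho : R) (L : 'M[R]_n.+1) :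
  0 < r -> (forall x, `|x - a| <= r -> {for x, continuous u}) ->
  (forall x, `|x - a| = r -> rho <= `|u x - p|) ->
  `|x0 - a| < r -> `|u x0 - p| < rho ->
  (forall x, `|x - a| <= r -> u x = u x0 -> x = x0) ->
  L \in unitmx ->
  (forall e : R, 0 < e -> exists2 d : R, 0 < d &
     forall h, `|h| < d -> `|u (h + x0) - u x0 - h *m L| <= e * `|h|) ->
  forall q, `|q - p| < rho -> exists2 x, `|x - a| <= r & u x = q.
Proof.
move=> r0 cu bd x0r qrho uniq uL du q' q'rho.
apply: contrapT => miss.
have miss' x : `|x - a| <= r -> u x <> q' by move=> xr ux; apply: miss; exists x.
have [U [cU U0 Uin [c c0 Uc]]] := omitted_value_extension r0 cu bd qrho q'rho uniq miss'.
(* [U] is constant from distance [3 * r] to [a] on; the fourth [r] bounds the distance from [x0] to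
   [a]. *)
have [||x xx0 Ux] := @simple_zero_not_unique R n U x0 c L (4 * r) cU _ c0 uL.
- move=> x xM; apply: Uc.
  have : `|x - x0| <= `|x - a| + `|x0 - a|.
    by rewrite [`|x0 - a|]distrC; apply: ler_distD.
  by lra.
- move=> e e0; have [d d0 hd] := du e e0.
  exists (Num.min d (r - `|x0 - a|)); first by rewrite lt_min d0 subr_gt0.
  move=> h; rewrite lt_min => /andP[hd1 hr]; rewrite Uin; first exact: hd.
  by rewrite -addrA; apply: le_trans (ler_normD _ _) _; lra.
by move/eqP: xx0; apply; exact: U0.
Qed.

(** * The outer measure lebN *)

Lemma nneseries_pair (R : realType) : exists2 f : nat -> nat * nat,
  (forall p, exists k, f k = p) &
  forall a : nat * nat -> \bar R, (forall p, 0 <= a p)%E ->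
   (\sum_(k <oo) a (f k) = \sum_(i <oo) \sum_(j <oo) a (i, j))%E.
Proof.
have /card_esym/ppcard_eqP[f] := card_nat2.
exists f => [p|a a0]; first by exists (f^-1%FUN p); rewrite invK ?inE.
rewrite nneseries_esumT; last by move=> k; exact: a0.
rewrite nneseries_esumT; last by move=> i; apply: nneseries_ge0 => j _ _; exact: a0.
under [RHS]eq_esum do rewrite nneseries_esumT//.
rewrite esum_esum //=.
rewrite (reindex_esum [set: nat] ([set: nat] `*`` (fun=> [set: nat])) f) //.
  by apply: eq_esum => k _; case: (f k).
have -> : [set: nat] `*`` (fun=> [set: nat]) = [set: nat * nat] by rewrite predeqE.
exact: bij.
Qed.

Section LebesgueOuter.
Context {R : realType} {n : nat}.
Local Notation V := 'rV[R]_n.+1.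
Implicit Types (A B : set V) (a b x y : V).

Definition le_rV a b := forall i, a ord0 i <= b ord0 i.

Lemma boxvol_ge0 a b : le_rV a b -> 0 <= boxvol a b.
Proof. by move=> ab; apply: prodr_ge0 => i _; rewrite subr_ge0. Qed.

(** Degenerate boxes are the filler of covers indexed by [nat]. Positive dimension matters: in
    dimension 0 the empty product would be 1. *)
Lemma boxvol0 a : boxvol a a = 0.
Proof. by rewrite /boxvol (bigD1 ord0) //= subrr mul0r. Qed.

Lemma lebN_ge0 A : (0 <= lebN A)%E.
Proof.
apply: le_ereal_inf_tmp => _ [a [b [ab [_ ->]]]].
by apply: nneseries_ge0 => k _ _; rewrite lee_fin boxvol_ge0 // => i; exact: ab.
Qed.

Lemma lebN_le A B : A `<=` B -> (lebN A <= lebN B)%E.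
Proof.
move=> AB; apply: ereal_inf_le_tmp => _ [a [b [ab [Bc ->]]]].
by exists a, b; split=> //; split=> //; exact: subset_trans Bc.
Qed.

Lemma lebN_cover A (a b : nat -> V) : (forall k, le_rV (a k) (b k)) ->
  A `<=` \bigcup_k box (a k) (b k) ->
  (lebN A <= \sum_(k <oo) (boxvol (a k) (b k))%:E)%E.
Proof. by move=> ab Ac; apply: ereal_inf_lbound; exists a, b. Qed.

Lemma lebN_box_le a b : le_rV a b -> (lebN (box a b) <= (boxvol a b)%:E)%E.
Proof.
move=> ab; pose b' (k : nat) := if k is 0%N then b else a.
have ab' k : le_rV a (b' k) by case: k => //= _ i.
apply: le_trans (@lebN_cover _ (fun=> a) b' ab' _) _.
  by move=> x bx; exists 0%N.
rewrite nneseries_recl //; last by move=> k _; rewrite lee_fin boxvol_ge0.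
rewrite eseries_cond eseries0 ?adde0 // => -[|k] //= _ _.
by rewrite boxvol0.
Qed.

Lemma lebN_set0 : lebN (set0 : set V) = 0%E.
Proof.
apply/le_anti; rewrite lebN_ge0 andbT; apply: le_trans (@lebN_le _ (box 0 0) _) _ => //.
by apply: le_trans (lebN_box_le _) _; rewrite ?boxvol0.
Qed.

Lemma lebN_adherent A (r : R) : (lebN A < r%:E)%E -> exists a b : nat -> V,
  [/\ forall k, le_rV (a k) (b k), A `<=` \bigcup_k box (a k) (b k) &
   (\sum_(k <oo) (boxvol (a k) (b k))%:E < r%:E)%E].
Proof.
by move=> /ereal_inf_lt[_ [a [b [ab [Ac ->]]]] h]; exists a, b.
Qed.

Lemma lebN_bigcup (A : nat -> set V) : (lebN (\bigcup_k A k) <= \sum_(k <oo) lebN (A k))%E.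
Proof.
have [[i ioo]|Aoo] := pselect (exists i, lebN (A i) = +oo%E).
  by rewrite (nneseries_pinfty _ _ ioo) ?leey // => k _; exact: lebN_ge0.
apply/lee_addgt0Pr => e e0.
apply: le_trans (epsilon_trick xpredT (fun k => lebN_ge0 (A k)) (ltW e0)).
have /choice[G /choice[H GH]] : forall k, exists a : nat -> V, exists b : nat -> V,
    [/\ forall j, le_rV (a j) (b j), A k `<=` \bigcup_j box (a j) (b j) &
     (\sum_(j <oo) (boxvol (a j) (b j))%:E <= lebN (A k) + (e / (2 ^ k.+1)%:R)%:E)%E].
  move=> k; have ek : 0 < e / (2 ^ k.+1)%:R by rewrite divr_gt0 // ltr0n expn_gt0.
  have /fineK Ak : lebN (A k) \is a fin_num.
    rewrite ge0_fin_numE ?lebN_ge0 // ltey; apply/eqP => h; apply: Aoo; by exists k.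
  have : (lebN (A k) < (fine (lebN (A k)) + e / (2 ^ k.+1)%:R)%:E)%E.
    by rewrite -{1}Ak lte_fin ltrDl.
  by move=> /lebN_adherent[a [b [ab Ac h]]]; exists a, b; split=> //; rewrite -Ak; exact: ltW.
have [f fsurj fsum] := @nneseries_pair R.
have GHle k : le_rV (G (f k).1 (f k).2) (H (f k).1 (f k).2).
  by have [h _ _] := GH (f k).1; exact: h.
apply: le_trans (lebN_cover GHle _) _.
  move=> x [k _]; have [_ h _] := GH k => /h[j _ xj].
  by have [m fm] := fsurj (k, j); exists m => //; rewrite fm.
rewrite (fsum (fun p => (boxvol (G p.1 p.2) (H p.1 p.2))%:E)) => [|p]; last first.
  by have [h _ _] := GH p.1; rewrite lee_fin boxvol_ge0.
apply: lee_nneseries => [k _ _|k _]; last by have [] := GH k.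
by apply: nneseries_ge0 => j _ _; have [h _ _] := GH k; rewrite lee_fin boxvol_ge0.
Qed.

Lemma lebN_setU A B : (lebN (A `|` B) <= lebN A + lebN B)%E.
Proof.
pose C (k : nat) := if k is 0%N then A else if k is 1%N then B else set0.
apply: le_trans (@lebN_le _ (\bigcup_k C k) _) _.
  by move=> x [Ax|Bx]; [exists 0%N|exists 1%N].
apply: le_trans (lebN_bigcup _) _.
rewrite nneseries_recl //; last by move=> k _; exact: lebN_ge0.
rewrite (nneseries_split 1 1) /=; last by move=> k _; exact: lebN_ge0.
rewrite big_nat1 eseries_cond eseries0 ?adde0 // => -[|[|k]] //= _ _.
exact: lebN_set0.
Qed.

Lemma lebN_bigcup0 (T : countType) (A : T -> set V) :
  (forall t, lebN (A t) = 0%E) -> lebN (\bigcup_t A t) = 0%E.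
Proof.
move=> A0; apply/le_anti; rewrite lebN_ge0 andbT.
pose C (k : nat) := if unpickle k is Some t then A t else set0.
apply: le_trans (@lebN_le _ (\bigcup_k C k) _) _.
  by move=> x [t _ xt]; exists (pickle t) => //; rewrite /C pickleK.
apply: le_trans (lebN_bigcup _) _; rewrite eseries0 // => k _ _.
by rewrite /C; case: unpickle => [t|]; [exact: A0|exact: lebN_set0].
Qed.

Lemma lebN_image_le (f : V -> V) (c : R) : 0 < c ->
  (forall a b, le_rV a b -> (lebN (f @` box a b) <= (c * boxvol a b)%:E)%E) ->
  forall A, (lebN (f @` A) <= c%:E * lebN A)%E.
Proof.
move=> c0 hf A.
have [Aoo|Afin] := eqVneq (lebN A) +oo%E.
  by rewrite Aoo mulry gtr0_sg // mul1e leey.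
have /fineK fA : lebN A \is a fin_num by rewrite ge0_fin_numE ?lebN_ge0 // ltey.
apply/lee_addgt0Pr => e e0.
have e1 : 0 < e / (c + 1) by rewrite divr_gt0 // addr_gt0.
have : (lebN A < (fine (lebN A) + e / (c + 1))%:E)%E by rewrite -{1}fA lte_fin ltrDl.
move=> /lebN_adherent[a [b [ab Ac h]]].
apply: le_trans (@lebN_le _ (\bigcup_k (f @` box (a k) (b k))) _) _.
  by move=> _ [x /Ac[k _ xk] <-]; exists k => //; exists x.
apply: le_trans (lebN_bigcup _) _.
apply: (@le_trans _ _ (\sum_(k <oo) (c%:E * (boxvol (a k) (b k))%:E))%E).
  by apply: lee_nneseries => k *; [exact: lebN_ge0|rewrite -EFinM; exact: hf].
rewrite nneseriesZl; last by move=> k _; rewrite lee_fin boxvol_ge0.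
apply: le_trans (lee_wpmul2l _ (ltW h)) _; first by rewrite lee_fin ltW.
rewrite -fA -!EFinM -EFinD lee_fin mulrDr lerD2l mulrCA ler_piMr ?ltW //.
by rewrite ltr_pdivrMr ?addr_gt0 // mul1r ltrDl.
Qed.

Lemma image_box_translate a b v : (fun x : V => x + v) @` box a b = box (a + v) (b + v).
Proof.
apply/seteqP; split => [_ [x bx <-] i|x bx].
  by rewrite !mxE lerD2r ltrD2r; exact: bx.
exists (x - v); last by rewrite subrK.
by move=> i; have := bx i; rewrite !mxE lerBrDr ltrBlDr.
Qed.

Lemma lebN_translate A v : (lebN ((fun x : V => (x + v)%R) @` A) <= lebN A)%E.
Proof.
rewrite -[leRHS]mul1e; apply: lebN_image_le => // a b ab.
rewrite image_box_translate mul1r.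
have -> : boxvol a b = boxvol (a + v) (b + v).
  by apply: eq_bigr => i _; rewrite !mxE opprD addrACA subrr addr0.
by apply: lebN_box_le => i; rewrite !mxE lerD2r.
Qed.

End LebesgueOuter.

(** * Boxes and linear images *)

Section Boxes.
Context {R : realType} {n : nat}.
Local Notation V := 'rV[R]_n.+1.
Implicit Types (A B : set V) (a b x y : V) (i j : 'I_n.+1) (t : R).

Definition upd x i t : V := \row_j (if j == i then t else x ord0 j).

Lemma boxvolD1 a b i :
  boxvol a b = (b ord0 i - a ord0 i) * \prod_(j | j != i) (b ord0 j - a ord0 j).
Proof. by rewrite /boxvol (bigD1 i). Qed.

Lemma boxvol_upd a b i s t :
  boxvol (upd a i s) (upd b i t) = (t - s) * \prod_(j | j != i) (b ord0 j - a ord0 j).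
Proof.
rewrite (boxvolD1 _ _ i) !mxE eqxx; congr (_ * _).
by apply: eq_bigr => j /negbTE ji; rewrite !mxE ji.
Qed.

Lemma upd_id x i : upd x i (x ord0 i) = x.
Proof. by apply/rowP => j; rewrite !mxE; case: eqP => [->|]. Qed.

Lemma boxvol_cut a b i t :
  boxvol a b = boxvol a (upd b i t) + boxvol (upd a i t) b.
Proof.
rewrite -{2}(upd_id a i) -{3}(upd_id b i) !boxvol_upd (boxvolD1 _ _ i) -mulrDl.
by congr (_ * _); ring.
Qed.

Lemma box_cut a b i t : box a b `<=` box a (upd b i t) `|` box (upd a i t) b.
Proof.
move=> x bx; have [xt|tx] := ltP (x ord0 i) t; [left|right] => j;
  by have := bx j; rewrite !mxE; case: eqP => [->|//] /andP[? ?]; apply/andP.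
Qed.

(** Half of Caratheodory's condition for a half-space, and all the additivity that [no_overlap]
    needs: the hyperplane cuts every covering box in two. *)
Lemma lebN_halfspace A i t :
  (lebN (A `&` [set x | (x ord0 i < t)%R]) + lebN (A `&` [set x | (t <= x ord0 i)%R])
   <= lebN A)%E.
Proof.
apply: le_ereal_inf_tmp => _ [a [b [ab [Ac ->]]]].
(* The cut is clamped to the box, so both pieces stay boxes when the hyperplane misses it. *)
pose s k := Num.min (Num.max t (a k ord0 i)) (b k ord0 i).
have ask k : a k ord0 i <= s k by rewrite /s le_min le_max lexx orbT ab.
have skb k : s k <= b k ord0 i by rewrite /s ge_min lexx orbT.
have ab1 k : le_rV (a k) (upd (b k) i (s k)).
  by move=> j; rewrite mxE; case: eqP => [->|_]; [exact: ask|exact: ab].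
have ab2 k : le_rV (upd (a k) i (s k)) (b k).
  by move=> j; rewrite mxE; case: eqP => [->|_]; [exact: skb|exact: ab].
apply: (@le_trans _ _ (\sum_(k <oo) (boxvol (a k) (upd (b k) i (s k)))%:E
   + \sum_(k <oo) (boxvol (upd (a k) i (s k)) (b k))%:E)%E).
  apply: leeD; apply: lebN_cover => // x [/Ac[k _ bx] /= xt]; exists k => // j;
    have := bx j; rewrite mxE; case: eqP => [->|//] /andP[h1 h2]; apply/andP; split=> //.
    by rewrite /s lt_min lt_max xt h2.
  by rewrite /s ge_min ge_max xt h1.
rewrite -nneseriesD; last 2 first.
- by move=> k _ _; rewrite lee_fin boxvol_ge0.
- by move=> k _ _; rewrite lee_fin boxvol_ge0.
rewrite le_eqVlt; apply/orP; left; apply/eqP; apply: eq_eseriesr => k _.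
by rewrite -EFinD -boxvol_cut.
Qed.

Lemma boxvol_enlarge a b (d : R) : 0 < d ->
  exists2 e : R, 0 < e & boxvol (a - const_mx e) (b + const_mx e) <= boxvol a b + d.
Proof.
move=> d0; pose p : {poly R} := \prod_i ((b ord0 i - a ord0 i)%:P + 'X *+ 2).
have pE e : boxvol (a - const_mx e) (b + const_mx e) = p.[e].
  rewrite /p horner_prod; apply: eq_bigr => i _.
  by rewrite !mxE hornerD hornerC hornerMn hornerX; ring.
have p0 : boxvol a b = p.[0].
  rewrite -pE; congr boxvol; apply/rowP => i; rewrite !mxE; ring.
have /cvgrPdist_lt /(_ _ d0) /nbhs_ballP[e /= e0 he] := @continuous_horner R p 0.
exists (e / 2); first by rewrite divr_gt0.
rewrite pE p0; have /he : ball (0 : R) e (e / 2).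
  by rewrite /ball /= sub0r normrN ger0_norm ?divr_ge0 ?ltW //; rewrite -[ltRHS]mulr1 ltr_pM2l // invf_lt1 // ltr1n.
by rewrite ltr_norml => /andP[h _]; lra.
Qed.

Definition cbox a b : set V := [set x | forall i, a ord0 i <= x ord0 i <= b ord0 i].

Lemma box_sub_cbox a b : box a b `<=` cbox a b.
Proof. by move=> x bx i; have /andP[-> /ltW] := bx i. Qed.

Lemma lebN_cbox_le a b : le_rV a b -> (lebN (cbox a b) <= (boxvol a b)%:E)%E.
Proof.
move=> ab; apply/lee_addgt0Pr => d d0; have [e e0 he] := boxvol_enlarge a b d0.
have ab' : le_rV (a - const_mx e) (b + const_mx e).
  by move=> i; rewrite !mxE; have := ab i; lra.
apply: le_trans (lebN_le _) (le_trans (lebN_box_le ab') _).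
  by move=> x bx i; have := bx i; rewrite !mxE; lra.
by rewrite -EFinD lee_fin.
Qed.

End Boxes.

(** * Linear maps and the determinant as volume factor *)

Section LinearImage.
Context {R : realType} {n : nat}.
Local Notation V := 'rV[R]_n.+1.
Implicit Types (A : set V) (a b x y : V) (i j : 'I_n.+1) (M T : 'M[R]_n.+1).

Definition volume_le (f : V -> V) (c : R) := forall A, (lebN (f @` A) <= c%:E * lebN A)%E.

Lemma volume_le_comp f g c d : 0 <= d ->
  volume_le f c -> volume_le g d -> volume_le (g \o f) (d * c).
Proof.
move=> d0 hf hg A; rewrite -image_comp; apply: le_trans (hg _) _.
by rewrite EFinM -muleA; apply: lee_wpmul2l; rewrite ?lee_fin.
Qed.

(** Negative entries reverse intervals, so the image of a half-open box is placed in a closed box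
    whose corners are sorted by [Num.min] and [Num.max]. *)
Lemma volume_le_diag (d : V) : (forall i, d ord0 i != 0) ->
  volume_le (mulmxr (diag_mx d)) `|\det (diag_mx d)|.
Proof.
move=> d0; rewrite det_diag; apply: lebN_image_le => [|a b ab].
  by rewrite normr_gt0; apply/prodf_neq0 => i _; exact: d0.
pose a' : V := \row_i Num.min (a ord0 i * d ord0 i) (b ord0 i * d ord0 i).
pose b' : V := \row_i Num.max (a ord0 i * d ord0 i) (b ord0 i * d ord0 i).
have ab' : le_rV a' b' by move=> i; rewrite !mxE le_max ge_min lexx.
apply: le_trans (lebN_le _) (le_trans (lebN_cbox_le ab') _).
  move=> _ [x bx <-] i; have /andP[h1 /ltW h2] := bx i.
  rewrite /= mul_mx_diag !mxE ge_min le_max.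
  have [d1|/ltW d1] := leP 0 (d ord0 i).
    by rewrite (ler_wpM2r d1 h1) (ler_wpM2r d1 h2) orbT.
  by rewrite (ler_wnM2r d1 h1) (ler_wnM2r d1 h2) orbT.
rewrite lee_fin /boxvol normr_prod -big_split /=; apply: ler_prod => i _.
rewrite !mxE subr_ge0 le_max ge_min lexx /=.
have := ab i; have [d1|d1] := leP 0 (d ord0 i) => ab1.
  have h := ler_wpM2r d1 ab1.
  by rewrite min_l // max_r // ger0_norm // -mulrBl mulrC.
have h := ler_wnM2r (ltW d1) ab1.
by rewrite min_r // max_l // ltr0_norm //; nra.
Qed.

Lemma volume_le_perm (s : 'S_n.+1) : volume_le (mulmxr (perm_mx s)) 1.
Proof.
apply: lebN_image_le => // a b ab.
have pE (x : V) : x *m perm_mx s = col_perm s^-1 x.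
  by rewrite col_permE invgK.
apply: le_trans (@lebN_le _ _ _ (box (col_perm s^-1 a) (col_perm s^-1 b)) _) _.
  by move=> _ [x bx <-] i; rewrite /= pE !mxE; exact: bx.
apply: le_trans (lebN_box_le _) _; first by move=> i; rewrite !mxE.
rewrite mul1r /boxvol [in leRHS](reindex_inj (@perm_inj _ (s^-1)%g)) /=.
by rewrite lee_fin; apply: ler_prod => i _; rewrite !mxE subr_ge0 ab lexx.
Qed.

Definition shear i j (t : R) x : V := upd x j (x ord0 j + t * x ord0 i).

(* Halving the box [k] times in direction [i] divides the overhang of each
   sheared piece by [2 ^ k]. *)
Lemma lebN_shear_box i j t a b (k : nat) : i != j -> le_rV a b ->
  (lebN (shear i j t @` box a b) <= (((b ord0 j - a ord0 j) +
     `|t| * (b ord0 i - a ord0 i) / 2 ^+ k) * ((b ord0 i - a ord0 i) *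
     \prod_(m | (m != j) && (m != i)) (b ord0 m - a ord0 m)))%:E)%E.
Proof.
move=> ij; elim: k a b => [|k IH] a b ab; last first.
  pose t0 := (a ord0 i + b ord0 i) / 2.
  have := ab i => abi.
  have ab1 : le_rV a (upd b i t0).
    by move=> l; rewrite mxE; case: eqP => [->|_]; [rewrite /t0; lra|exact: ab].
  have ab2 : le_rV (upd a i t0) b.
    by move=> l; rewrite mxE; case: eqP => [->|_]; [rewrite /t0; lra|exact: ab].
  apply: le_trans (@lebN_le _ _ _ (shear i j t @` box a (upd b i t0) `|` shear i j t @` box (upd a i t0) b) _) _.
    by rewrite -image_setU; apply: image_subset; exact: box_cut.
  apply: le_trans (lebN_setU _ _) _.
  apply: le_trans (leeD (IH _ _ ab1) (IH _ _ ab2)) _.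
  rewrite -EFinD lee_fin !mxE eqxx (negbTE (_ : j != i)) 1?eq_sym //.
  set W := \prod_(_ | _) (b ord0 _ - a ord0 _).
  have -> : \prod_(m | (m != j) && (m != i)) (upd b i t0 ord0 m - a ord0 m) = W.
    by apply: eq_bigr => m /andP[_ /negbTE mi]; rewrite mxE mi.
  have -> : \prod_(m | (m != j) && (m != i)) (b ord0 m - upd a i t0 ord0 m) = W.
    by apply: eq_bigr => m /andP[_ /negbTE mi]; rewrite mxE mi.
  move: W => W; rewrite le_eqVlt; apply/orP; left; apply/eqP.
  rewrite /t0 exprS invfM; field.
  by rewrite expf_neq0.
rewrite expr0 divr1.
have hm : `|t| * (b ord0 i - a ord0 i) =
    Num.max (t * a ord0 i) (t * b ord0 i) - Num.min (t * a ord0 i) (t * b ord0 i).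
  have := ab i; have [t0|t0] := leP 0 t => abi.
    have h := ler_wpM2l t0 abi.
    by rewrite max_r // min_l // ger0_norm // mulrBr.
  have h := ler_wnM2l (ltW t0) abi.
  by rewrite max_l // min_r // ltr0_norm //; ring.
pose a' := upd a j (a ord0 j + Num.min (t * a ord0 i) (t * b ord0 i)).
pose b' := upd b j (b ord0 j + Num.max (t * a ord0 i) (t * b ord0 i)).
have ab' : le_rV a' b'.
  move=> l; rewrite /a' /b' !mxE; case: eqP => [_|_]; last exact: ab.
  by apply: lerD; rewrite ?ab // le_max ge_min lexx.
apply: le_trans (lebN_le _) (le_trans (lebN_box_le ab') _).
  move=> _ [x bx <-] l; rewrite /a' /b' /shear !mxE; case: eqP => [_|_]; last exact: bx.
  have /andP[h1 h2] := bx i; have /andP[h3 h4] := bx j.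
  apply/andP; split.
    apply: lerD => //; rewrite ge_min; have [t0|/ltW t0] := leP 0 t.
      by rewrite (ler_wpM2l t0 h1).
    by rewrite (ler_wnM2l t0 (ltW h2)) orbT.
  apply: ltr_leD => //; rewrite le_max; have [t0|/ltW t0] := leP 0 t.
    by rewrite (ler_wpM2l t0 (ltW h2)) orbT.
  by rewrite (ler_wnM2l t0 h1).
rewrite lee_fin boxvol_upd hm [X in _ * X <= _](bigD1 i) //= le_eqVlt.
by apply/orP; left; apply/eqP; congr (_ * _); ring.
Qed.

Lemma volume_le_shear i j t : i != j -> volume_le (shear i j t) 1.
Proof.
move=> ij; apply: lebN_image_le => // a b ab; rewrite mul1r.
apply/lee_addgt0Pr => e e0.
pose C := `|t| * (b ord0 i - a ord0 i) * ((b ord0 i - a ord0 i) *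
     \prod_(m | (m != j) && (m != i)) (b ord0 m - a ord0 m)).
(* Then [2 ^ k] exceeds [C / e], and the overhang costs at most [e]. *)
pose k := (Num.truncn (C / e)).+1.
apply: le_trans (lebN_shear_box t k ij ab) _.
rewrite -EFinD lee_fin (boxvolD1 _ _ j) [X in _ <= _ * X + _](bigD1 i) //=.
rewrite mulrDl lerD2l mulrAC -/C ler_pdivrMr ?exprn_gt0 // mulrC -ler_pdivrMr //.
apply: ltW; apply: lt_trans (truncnS_gt _) _; rewrite -/k.
by rewrite -natrX ltr_nat ltn_expl.
Qed.

Lemma volume_le_col (s : seq 'I_n.+1) j (t : 'I_n.+1 -> R) : j \notin s ->
  volume_le (fun x => upd x j (x ord0 j + \sum_(i <- s) t i * x ord0 i)) 1.
Proof.
elim: s => [_ A|i s IH].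
  rewrite mul1e (_ : _ @` A = A) //.
  rewrite -[RHS]image_id; apply: eq_imagel => x _.
  by rewrite big_nil addr0 upd_id.
rewrite inE negb_or => /andP[ji js].
have h := volume_le_comp ler01 (volume_le_shear (t i) (_ : i != j)) (IH js).
move=> A; have := h _ A; rewrite mulr1 => /(_ _)/wrap[]; first by rewrite eq_sym.
congr (lebN _ <= _)%E; apply: eq_imagel => x _ /=.
apply/rowP => l; rewrite !mxE; case: eqP => // _; rewrite eqxx big_cons -addrA.
congr (_ + (_ + _)); rewrite [LHS]big_seq [RHS]big_seq; apply: eq_bigr => m ms.
by rewrite mxE; case: eqP => // mj; rewrite -mj ms in js.
Qed.

(** Interpolates between the identity and [T]; adding one column amounts to a composition of
    shears. *)
Definition col_select (P : pred 'I_n.+1) T : 'M[R]_n.+1 :=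
  \matrix_(i, j) (if P j then T i j else (i == j)%:R).

(** Column [k] is filled in after the coordinates in [P] have been altered. Since [T l k = 0] for
    [P l], it reads only unaltered coordinates, so the two maps compose to the enlarged matrix. *)
Lemma volume_le_col_select (P Q : pred 'I_n.+1) T k :
  (forall j, Q j = P j || (j == k)) -> ~~ P k -> T k k = 1 ->
  (forall l, P l -> T l k = 0) ->
  volume_le (mulmxr (col_select P T)) 1 -> volume_le (mulmxr (col_select Q T)) 1.
Proof.
move=> QE Pk Tk Tl hP A.
pose s := [seq l <- enum 'I_n.+1 | l != k].
have ks : k \notin s by rewrite mem_filter eqxx.
have := volume_le_comp ler01 hP (volume_le_col (fun l => T l k) ks) A.
rewrite mulr1; congr (lebN _ <= _)%E; apply: eq_imagel => x _ /=.
apply/rowP => j; rewrite !mxE; case: eqP => [->|/eqP jk]; last first.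
  apply: eq_bigr => i _; rewrite !mxE QE (negbTE jk) orbF //.
rewrite big_filter big_enum_cond /=.
have xk : \sum_i x ord0 i * col_select P T i k = x ord0 k.
  rewrite (bigD1 k) //= big1 => [|i /negbTE ik]; rewrite mxE (negbTE Pk) ?ik ?mulr0 //.
  by rewrite eqxx mulr1 addr0.
rewrite xk [RHS](bigD1 k) //= mxE QE eqxx orbT Tk mulr1; congr (_ + _).
apply: eq_bigr => l lk; rewrite !mxE QE eqxx orbT mulrC.
have [Pl|Pl] := boolP (P l); first by rewrite Tl // !mulr0.
congr (_ * _); rewrite (bigD1 l) //= big1 => [|i /negbTE il]; rewrite mxE (negbTE Pl) ?il ?mulr0 //.
by rewrite eqxx mulr1 addr0.
Qed.

Lemma col_select0 T : volume_le (mulmxr (col_select pred0 T)) 1.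
Proof.
move=> A; rewrite mul1e (_ : _ @` A = A) //.
rewrite -[RHS]image_id; apply: eq_imagel => x _ /=.
by rewrite (_ : col_select _ _ = 1%:M) ?mulmx1 //; apply/matrixP => i j; rewrite !mxE.
Qed.

Lemma col_selectT (P : pred 'I_n.+1) T : (forall j, P j) -> col_select P T = T.
Proof. by move=> hP; apply/matrixP => i j; rewrite mxE hP. Qed.

(** The order matters: a lower triangular column reads only later coordinates, so columns are filled
    from first to last; the upper triangular case runs backwards. *)
Lemma volume_le_lower T : (forall i, T i i = 1) ->
  (forall i j : 'I_n.+1, (i < j)%N -> T i j = 0) -> volume_le (mulmxr T) 1.
Proof.
move=> T1 T0; rewrite -[T](@col_selectT (fun j => (j < n.+1)%N)) //.
suff h (k : nat) : (k <= n.+1)%N ->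
  volume_le (mulmxr (col_select (fun j : 'I_n.+1 => (j < k)%N) T)) 1 by exact: h.
elim: k => [_|k IH kn].
  have -> : (fun j : 'I_n.+1 => (j < 0)%N) = pred0 by apply/funext.
  exact: col_select0.
apply: (@volume_le_col_select (fun j => (j < k)%N) _ _ (Ordinal kn)) => //=.
- by move=> j; rewrite ltnS leq_eqVlt -val_eqE /= orbC.
- by rewrite ltnn.
- by move=> l lk; apply: T0.
- exact/IH/ltnW.
Qed.

Lemma volume_le_upper T : (forall i, T i i = 1) ->
  (forall i j : 'I_n.+1, (j < i)%N -> T i j = 0) -> volume_le (mulmxr T) 1.
Proof.
(* The full predicate is written in the shape [n.+1 - k] on which the induction runs. *)
move=> T1 T0; rewrite -[T](@col_selectT (fun j => (n.+1 - n.+1 <= j)%N)); last first.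
  by move=> j; rewrite subnn.
suff h (k : nat) : (k <= n.+1)%N ->
  volume_le (mulmxr (col_select (fun j : 'I_n.+1 => (n.+1 - k <= j)%N) T)) 1 by exact: h.
elim: k => [_|k IH kn].
  have -> : (fun j : 'I_n.+1 => (n.+1 - 0 <= j)%N) = pred0.
    by apply/funext => j; rewrite subn0 leqNgt ltn_ord.
  exact: col_select0.
have kn' : (n.+1 - k.+1 < n.+1)%N by lia.
apply: (@volume_le_col_select (fun j => (n.+1 - k <= j)%N) _ _ (Ordinal kn')) => //=.
- by move=> j; rewrite -val_eqE /=; lia.
- by lia.
- by move=> l lk; apply: T0 => /=; lia.
- exact/IH/ltnW.
Qed.

Lemma volume_le_mul M T c d : 0 <= d ->
  volume_le (mulmxr M) c -> volume_le (mulmxr T) d -> volume_le (mulmxr (M *m T)) (d * c).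
Proof.
move=> d0 hM hT A; have := volume_le_comp d0 hM hT A.
by congr (lebN _ <= _)%E; apply: eq_imagel => x _ /=; rewrite mulmxA.
Qed.

(** In the LUP decomposition the permutation and the unit triangular matrices have factor 1; the
    diagonal is split off [U] and carries the whole determinant. *)
Lemma lebN_linear M : M \in unitmx -> volume_le (mulmxr M) `|\det M|.
Proof.
move=> uM; have := cormen_lup_correct M; have := cormen_lup_perm M.
have := cormen_lup_detL M; have := @cormen_lup_lower _ _ M; have := @cormen_lup_upper _ _ M.
case: cormen_lup => [[P L] U] /= U0 L0 detL /is_perm_mxP[s ->] PM.
have dU : `|\det M| = `|\det U|.
  have : \det (perm_mx s * M) = \det (L * U) by rewrite PM.
  rewrite !det_mulmx detL mul1r det_perm => <-.
  by rewrite normrM normrX normrN1 expr1n mul1r.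
have detU : \det U = \prod_i U i i.
  rewrite -det_tr det_trig; first by apply: eq_bigr => i _; rewrite mxE.
  by apply/is_trig_mxP => i j ij; rewrite mxE U0.
have Un0 i : U i i != 0.
  have : \det U != 0 by rewrite -normr_gt0 -dU normr_gt0 -unitfE -unitmxE.
  by rewrite detU => /prodf_neq0 /(_ i isT).
pose d : V := \row_i U i i.
pose U' := \matrix_(i, j) (U i j / U j j).
have UE : U = U' *m diag_mx d.
  by apply/matrixP => i j; rewrite mul_mx_diag !mxE divfK.
have dd : \det U = \det (diag_mx d).
  by rewrite detU det_diag; apply: eq_bigr => i _; rewrite mxE.
rewrite dU; have -> : M = perm_mx s^-1 *m (L *m U).
  have -> : L *m U = perm_mx s *m M by exact: esym PM.
  by rewrite mulmxA -perm_mxM mulVg perm_mx1 mul1mx.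
have hU : volume_le (mulmxr U) `|\det U|.
  rewrite {1}UE dd -[X in volume_le _ X]mulr1; apply: volume_le_mul => //.
    apply: volume_le_upper => [i|i j ij]; rewrite mxE ?divff //.
    by rewrite U0 // mul0r.
  by apply: volume_le_diag => i; rewrite mxE.
have hL : volume_le (mulmxr L) 1.
  apply: volume_le_lower => [i|i j ij]; rewrite L0 ?eqxx //; last exact: ltnW.
  by rewrite -val_eqE /= ltn_eqF.
rewrite -[X in volume_le _ X]mulr1; apply: volume_le_mul => //; first exact: volume_le_perm.
by rewrite -[X in volume_le _ X]mulr1; apply: volume_le_mul.
Qed.

End LinearImage.

(** * Bisection of boxes *)

Lemma ord_pos_lower_bound (R : realType) (n : nat) (f : 'I_n -> R) :
  (forall i, 0 < f i) -> exists2 e : R, 0 < e & forall i, e <= f i.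
Proof.
move=> f0; exists (\big[Num.min/1]_i f i) => [|i]; last exact: bigmin_le_cond.
by elim/big_ind: _ => // x y x0 y0; rewrite lt_min x0.
Qed.

Lemma exists_expr_half_lt (R : realType) (d : R) : 0 < d -> exists m : nat, 2 ^- m < d.
Proof.
move=> d0; exists (Num.truncn d^-1).+1; rewrite invf_plt ?posrE ?exprn_gt0 //.
by apply: lt_trans (truncnS_gt _) _; rewrite -natrX ltr_nat ltn_expl.
Qed.

Lemma interval_overlap_cut (R : realType) (P Q A B t : R) :
  P <= Q -> A <= t -> t <= B ->
  Num.max 0 (Num.min Q B - Num.max P A) =
  Num.max 0 (Num.min Q t - Num.max P A) + Num.max 0 (Num.min Q B - Num.max P t).
Proof.
move=> PQ At tB.
by case: (leP Q B) => h1; case: (leP P A) => h2; case: (leP Q t) => h3;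
   case: (leP P t) => h4; do ?[case: leP => ?]; lra.
Qed.

Section Bisection.
Context {R : realType} {n : nat}.
Local Notation V := 'rV[R]_n.+1.
Implicit Types (a b p q x y : V) (good : V -> V -> Prop).

Definition halving_stable good := forall a b i, le_rV a b ->
  good a (upd b i ((a ord0 i + b ord0 i) / 2)) ->
  good (upd a i ((a ord0 i + b ord0 i) / 2)) b -> good a b.

(** The box is halved in one direction after the other, always keeping a bad half; after all
    directions the result is similar to the original box. *)
Lemma bad_half good a b : halving_stable good -> le_rV a b -> ~ good a b ->
  exists a', [/\ le_rV a a', le_rV (a' + 2^-1 *: (b - a)) b &
    ~ good a' (a' + 2^-1 *: (b - a))].
Proof.
move=> hg ab nab.
have h (k : nat) : (k <= n.+1)%N -> exists a' b', ~ good a' b' /\ forall i : 'I_n.+1,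
    if (i < k)%N then [/\ b' ord0 i = a' ord0 i + 2^-1 * (b ord0 i - a ord0 i),
      a ord0 i <= a' ord0 i & b' ord0 i <= b ord0 i]
    else a' ord0 i = a ord0 i /\ b' ord0 i = b ord0 i.
  elim: k => [_|k IH kn]; first by exists a, b.
  have [a' [b' [nab' h]]] := IH (ltnW kn).
  pose i := Ordinal kn; have := h i; rewrite /= ltnn => -[ai bi].
  have abi := ab i.
  have ab' : le_rV a' b'.
    move=> j; have := ab j; have := h j; case: ifP => _; last by case=> -> ->.
    by case=> -> _ _; lra.
  set t := (a' ord0 i + b' ord0 i) / 2.
  have [g1|g1] := pselect (good a' (upd b' i t)); last first.
    exists a', (upd b' i t); split=> // j; rewrite !mxE -val_eqE /= ltnS.
    have [jk|jk|jk] := ltngtP j k.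
    - by have := h j; rewrite jk.
    - by have := h j; rewrite ltnNge (ltnW jk).
    - have -> : j = i by exact: val_inj.
      by rewrite /t ai bi; split; lra.
  exists (upd a' i t), b'; split=> [g2|j]; first by apply: nab'; apply: (hg _ _ i).
  rewrite !mxE -val_eqE /= ltnS.
  have [jk|jk|jk] := ltngtP j k.
  - by have := h j; rewrite jk.
  - by have := h j; rewrite ltnNge (ltnW jk).
  - have -> : j = i by exact: val_inj.
    by rewrite /t ai bi; split; lra.
have [a' [b' [nab' h']]] := h n.+1 (leqnn _).
have b'E : b' = a' + 2^-1 *: (b - a).
  by apply/rowP => i; have := h' i; rewrite ltn_ord !mxE => -[].
exists a'; rewrite -b'E; split=> // i; have := h' i; rewrite ltn_ord => -[] //.
Qed.

(** A failure would yield nested bad boxes with a common point, near which small boxes are good.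
    Only scaled copies of the whole box have to be tested locally; this fixed shape is what bounds
    diameter against volume in the Lipschitz estimate. *)
Lemma cousin_box good a b : halving_stable good -> le_rV a b ->
  (forall x, cbox a b x -> exists2 d : R, 0 < d & forall (c : R) a', 0 < c -> c < d ->
     cbox a' (a' + c *: (b - a)) x -> good a' (a' + c *: (b - a))) ->
  good a b.
Proof.
move=> hg ab hloc; apply: contrapT => nab.
pose s := b - a; have s0 i : 0 <= s ord0 i by rewrite !mxE subr_ge0 ab.
pose bad (m : nat) a' := ~ good a' (a' + 2 ^- m *: s).
have /choice[F HF] : forall ma : nat * V, exists a'', bad ma.1 ma.2 ->
    [/\ le_rV ma.2 a'', le_rV (a'' + 2 ^- ma.1.+1 *: s) (ma.2 + 2 ^- ma.1 *: s) &
     bad ma.1.+1 a''].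
  move=> [m a'] /=; have [ba|] := pselect (bad m a'); last by exists a'.
  have le1 : le_rV a' (a' + 2 ^- m *: s).
    by move=> i; have := s0 i; rewrite !mxE => h; rewrite lerDl mulr_ge0 ?invr_ge0 ?exprn_ge0.
  have [a'' []] := bad_half hg le1 ba.
  have -> : a' + 2 ^- m *: s - a' = 2 ^- m *: s by rewrite addrC addKr.
  by rewrite scalerA -invfM -exprS => ? ? ?; exists a''.
pose a_ := fix a_ (m : nat) := if m is m'.+1 then F (m', a_ m') else a.
have ba m : bad m (a_ m).
  elim: m => [|m IH]; first by rewrite /bad expr0 invr1 scale1r addrC subrK.
  by have [] := HF (m, a_ m) IH.
have aS m : le_rV (a_ m) (a_ m.+1) by have [] := HF (m, a_ m) (ba m).
have bS m : le_rV (a_ m.+1 + 2 ^- m.+1 *: s) (a_ m + 2 ^- m *: s).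
  by have [] := HF (m, a_ m) (ba m).
have amono m k : le_rV (a_ m) (a_ (m + k)%N).
  elim: k => [|k IH] i; first by rewrite addn0.
  by apply: le_trans (IH i) _; rewrite addnS; exact: aS.
have bmono m k : le_rV (a_ (m + k)%N + 2 ^- (m + k) *: s) (a_ m + 2 ^- m *: s).
  elim: k => [|k IH] i; first by rewrite addn0.
  by apply: le_trans (IH i); rewrite addnS; exact: bS.
have ale m k i : a_ k ord0 i <= (a_ m + 2 ^- m *: s) ord0 i.
  have h j : a_ j ord0 i <= (a_ j + 2 ^- j *: s) ord0 i.
    by have := s0 i; rewrite !mxE => h; rewrite lerDl mulr_ge0 ?invr_ge0 ?exprn_ge0.
  have [mk|km] := leqP m k.
    by apply: le_trans (h k) _; rewrite -(subnKC mk); exact: bmono.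
  by apply: le_trans (h m); rewrite -(subnKC (ltnW km)); exact: amono.
(* Lower corners increase and stay below every upper corner, so their supremum lies in all the
   boxes. *)
pose x : V := \row_i sup (range (fun m => a_ m ord0 i)).
have xge m i : a_ m ord0 i <= x ord0 i.
  rewrite mxE; apply: ub_le_sup; last by exists m.
  by exists ((a_ 0%N + 2 ^- 0 *: s) ord0 i) => _ [k _ <-]; exact: ale.
have xle m i : x ord0 i <= (a_ m + 2 ^- m *: s) ord0 i.
  rewrite mxE; apply: ge_sup; first by exists (a_ 0%N ord0 i); exists 0%N.
  by move=> _ [k _ <-]; exact: ale.
have [d d0 hd] : exists2 d : R, 0 < d & forall (c : R) a', 0 < c -> c < d ->
     cbox a' (a' + c *: (b - a)) x -> good a' (a' + c *: (b - a)).
  apply: hloc => i; rewrite (xge 0%N) /=.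
  by have := xle 0%N i; rewrite expr0 invr1 scale1r addrC subrK.
have [m hm] := exists_expr_half_lt d0.
apply: (ba m); apply: hd => //.
by move=> i; rewrite xge xle.
Qed.

(** The volume of the intersection of two boxes. It is additive when the box from [a] to [b] is cut,
    which allows a countable cover to be charged locally. *)
Definition overlap p q a b : R :=
  \prod_i Num.max 0 (Num.min (q ord0 i) (b ord0 i) - Num.max (p ord0 i) (a ord0 i)).

Lemma overlap_ge0 p q a b : 0 <= overlap p q a b.
Proof. by apply: prodr_ge0 => i _; rewrite le_max lexx. Qed.

Lemma overlap_le p q a b : le_rV p q -> overlap p q a b <= boxvol p q.
Proof.
move=> pq; apply: ler_prod => i _; rewrite le_max lexx /= ge_max subr_ge0 pq /=.
by rewrite lerB // ?ge_min ?le_max lexx.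
Qed.

Lemma overlap_sub p q a b : le_rV a b -> le_rV p a -> le_rV b q ->
  overlap p q a b = boxvol a b.
Proof.
move=> ab pa bq; apply: eq_bigr => i _.
by rewrite (min_r (bq i)) (max_r (pa i)) max_r // subr_ge0 ab.
Qed.

Lemma overlap_cut p q a b i t : le_rV p q -> a ord0 i <= t <= b ord0 i ->
  overlap p q a b = overlap p q a (upd b i t) + overlap p q (upd a i t) b.
Proof.
move=> pq /andP[at_ tb].
have D a' b' : overlap p q a' b' =
    Num.max 0 (Num.min (q ord0 i) (b' ord0 i) - Num.max (p ord0 i) (a' ord0 i)) *
    \prod_(j | j != i) Num.max 0 (Num.min (q ord0 j) (b' ord0 j)
      - Num.max (p ord0 j) (a' ord0 j)) by rewrite /overlap (bigD1 i).
rewrite !D [upd b i t ord0 i]mxE [upd a i t ord0 i]mxE eqxx.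
pose W := \prod_(j | j != i) Num.max 0 (Num.min (q ord0 j) (b ord0 j)
      - Num.max (p ord0 j) (a ord0 j)).
have W1 : \prod_(j | j != i) Num.max 0 (Num.min (q ord0 j) (upd b i t ord0 j)
    - Num.max (p ord0 j) (a ord0 j)) = W.
  by apply: eq_bigr => j /negbTE ji; rewrite mxE ji.
have W2 : \prod_(j | j != i) Num.max 0 (Num.min (q ord0 j) (b ord0 j)
    - Num.max (p ord0 j) (upd a i t ord0 j)) = W.
  by apply: eq_bigr => j /negbTE ji; rewrite mxE ji.
rewrite W1 W2 -/W -mulrDl; congr (_ * _).
exact: interval_overlap_cut.
Qed.

(** Each covering box is enlarged by its share of the slack below [r]. Every point of [A] is then
    interior to some covering box, which contains all small boxes around it. *)
Lemma lebN_open_cover (A : set V) (r : R) : (lebN A < r%:E)%E -> exists p q : nat -> V,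
  [/\ forall k, le_rV (p k) (q k),
   forall x, A x -> exists k, forall i, p k ord0 i < x ord0 i < q k ord0 i &
   (\sum_(k <oo) (boxvol (p k) (q k))%:E <= r%:E)%E].
Proof.
move=> /lebN_adherent[a [b [ab Ac hr]]].
have v0 k : (0 <= (boxvol (a k) (b k))%:E)%E by rewrite lee_fin boxvol_ge0.
have S0 := @nneseries_ge0 R _ xpredT 0 (fun k _ _ => v0 k).
have /fineK SE : (\sum_(k <oo) (boxvol (a k) (b k))%:E)%E \is a fin_num.
  by rewrite ge0_fin_numE //; exact: lt_trans hr (ltry _).
pose d := r - fine (\sum_(k <oo) (boxvol (a k) (b k))%:E)%E.
have d0 : 0 < d by rewrite subr_gt0 -lte_fin SE.
have /choice[e He] : forall k : nat, exists e : R, 0 < e /\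
    boxvol (a k - const_mx e) (b k + const_mx e) <= boxvol (a k) (b k) + d / (2 ^ k.+1)%:R.
  move=> k; have dk : 0 < d / (2 ^ k.+1)%:R by rewrite divr_gt0 // ltr0n expn_gt0.
  by have [e e0 he] := boxvol_enlarge (a k) (b k) dk; exists e.
exists (fun k => a k - const_mx (e k)), (fun k => b k + const_mx (e k)).
have ab' k : le_rV (a k - const_mx (e k)) (b k + const_mx (e k)).
  by move=> i; rewrite !mxE; have := ab k i; have [e0 _] := He k; lra.
split=> //.
- move=> x /Ac[k _ bx]; exists k => i; have := bx i; have [e0 _] := He k.
  by rewrite !mxE => /andP[h1 h2]; apply/andP; split; lra.
- apply: le_trans (lee_nneseries (v := fun k =>
    ((boxvol (a k) (b k))%:E + (d / (2 ^ k.+1)%:R)%:E)%E) _ _) _.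
  + by move=> k _ _; rewrite lee_fin boxvol_ge0.
  + by move=> k _; rewrite -EFinD lee_fin; have [] := He k.
  apply: le_trans (epsilon_trick xpredT v0 (ltW d0)) _.
  by rewrite -SE -EFinD lee_fin /d addrC subrK.
Qed.

Lemma small_box_sub p q s x : (forall i, p ord0 i < x ord0 i < q ord0 i) ->
  exists2 d : R, 0 < d & forall (c : R) a', 0 < c -> c < d ->
    cbox a' (a' + c *: s) x -> le_rV p a' /\ le_rV (a' + c *: s) q.
Proof.
move=> pxq.
have pos i : 0 < Num.min (x ord0 i - p ord0 i) (q ord0 i - x ord0 i).
  by rewrite lt_min !subr_gt0.
have [e e0 he] := ord_pos_lower_bound pos.
exists (e / (`|s| + 1)) => [|c a' c0 cd xa]; first by rewrite divr_gt0 // ltr_wpDl.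
have cs i : c * s ord0 i <= e.
  apply: le_trans (_ : c * (`|s| + 1) <= _); last by rewrite -ler_pdivlMr ?ltW // ltr_wpDl.
  apply: ler_wpM2l; first exact: ltW.
  by have := le_trans (ler_norm _) (ler_coord_norm s i); lra.
have H i : [/\ p ord0 i + c * s ord0 i <= x ord0 i & x ord0 i + c * s ord0 i <= q ord0 i].
  have := he i; rewrite le_min => /andP[h1 h2]; have := cs i.
  by split; lra.
split=> i; have [h1 h2] := H i; have := xa i; rewrite !mxE => /andP[h3 h4]; lra.
Qed.

End Bisection.

(** * Images of boxes *)

Section ImageBox.
Context {R : realType} {n : nat}.
Local Notation V := 'rV[R]_n.+1.
Implicit Types (a b p q x y : V).

(** Bisection replaces a finite subcover: bounding the volume by the total overlap with an open
    cover survives halving and is immediate for a box inside one covering box. *)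
Lemma lebN_cbox_ge a b : le_rV a b -> ((boxvol a b)%:E <= lebN (cbox a b))%E.
Proof.
move=> ab; apply/lee_addgt0Pr => e e0.
have cfin : lebN (cbox a b) \is a fin_num.
  rewrite ge0_fin_numE ?lebN_ge0 //; apply: le_lt_trans (lebN_cbox_le ab) (ltry _).
have : (lebN (cbox a b) < (fine (lebN (cbox a b)) + e)%:E)%E.
  by rewrite -{1}(fineK cfin) lte_fin ltrDl.
move=> /lebN_open_cover[p [q [pq cov hs]]].
rewrite -(fineK cfin) -EFinD; apply: le_trans hs.
pose good a' b' := ((boxvol a' b')%:E <= \sum_(k <oo) (overlap (p k) (q k) a' b')%:E)%E.
have ov0 a' b' k : (0 <= (overlap (p k) (q k) a' b')%:E)%E by rewrite lee_fin overlap_ge0.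
suff : good a b.
  move=> /le_trans; apply; apply: lee_nneseries => k *; first exact: ov0.
  by rewrite lee_fin overlap_le.
apply: (@cousin_box _ _ good) => // [a' b' i ab' g1 g2|x /cov[k xk]].
  rewrite /good (boxvol_cut _ _ i ((a' ord0 i + b' ord0 i) / 2)) EFinD.
  move: g1 g2; rewrite /good => g1 g2; apply: le_trans (leeD g1 g2) _; rewrite -nneseriesD // le_eqVlt; apply/orP; left.
  apply/eqP; apply: eq_eseriesr => k _; rewrite -EFinD -overlap_cut //.
  by have := ab' i; lra.
have [d d0 hd] := small_box_sub (b - a) xk; exists d => // c a' c0 cd xa.
have [pa aq] := hd c a' c0 cd xa.
have ab' : le_rV a' (a' + c *: (b - a)).
  by move=> i; rewrite !mxE lerDl mulr_ge0 ?(ltW c0) // subr_ge0.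
rewrite /good -(overlap_sub ab' pa aq) (nneseriesD1 (n := k)) //.
by rewrite leeDl // nneseries_ge0.
Qed.

Definition has_diff (u : V -> V) x (L : 'M[R]_n.+1) := forall e : R, 0 < e ->
  exists2 d : R, 0 < d & forall h, `|h| < d -> `|u (h + x) - u x - h *m L| <= e * `|h|.

Lemma box_near a (s x y : V) (c : R) : 0 < c -> (forall i, 0 <= s ord0 i) ->
  cbox a (a + c *: s) x -> cbox a (a + c *: s) y -> `|y - x| <= c * `|s|.
Proof.
move=> c0 s0 hx hy; apply: rV_norm_le => [|i]; first by rewrite mulr_ge0 // ltW.
have := hx i; have := hy i; have := le_trans (ler_norm _) (ler_coord_norm s i).
rewrite -(ler_pM2l c0) !mxE ler_norml => h1 /andP[h2 h3] /andP[h4 h5].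
by apply/andP; split; lra.
Qed.

Lemma boxvol_scale a (s : V) (c : R) (e : R) :
  boxvol (a - const_mx (c * e)) (a + c *: s + const_mx (c * e))
  = c ^+ n.+1 * \prod_i (s ord0 i + 2 * e).
Proof.
rewrite -[X in _ ^+ X]card_ord -prodr_const -big_split /=.
by apply: eq_bigr => i _; rewrite !mxE; ring.
Qed.

Lemma boxvol_scale0 a (s : V) (c : R) :
  boxvol a (a + c *: s) = c ^+ n.+1 * \prod_i s ord0 i.
Proof.
rewrite -[X in _ ^+ X]card_ord -prodr_const -big_split /=.
by apply: eq_bigr => i _; rewrite !mxE; ring.
Qed.

(** The image lies in an affine image of the box enlarged by [c * eta] on each side, where [eta]
    makes the enlargement cost at most a factor [1 + e] at every scale [c]. *)
Lemma image_box_diff (u : V -> V) x L (s : V) (e : R) : (forall i, 0 < s ord0 i) ->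
  0 < e -> `|\det L| = 1 -> has_diff u x L ->
  exists2 d : R, 0 < d & forall (c : R) a', 0 < c -> c < d -> cbox a' (a' + c *: s) x ->
    (lebN (u @` box a' (a' + c *: s)) <= ((1 + e) * boxvol a' (a' + c *: s))%:E)%E.
Proof.
move=> s0 e0 detL du.
have s0' i : 0 <= s ord0 i by exact: ltW.
have uL : L \in unitmx by rewrite unitmxE unitfE -normr_gt0 detL.
have [D D0 hD] := mulmx_bounded (invmx L).
pose vs := \prod_i s ord0 i.
have vs0 : 0 < vs by apply: prodr_gt0.
have [eta eta0 heta] := boxvol_enlarge 0 s (mulr_gt0 e0 vs0).
have {}heta : \prod_i (s ord0 i + 2 * eta) <= (1 + e) * vs.
  have E1 : boxvol 0 s = vs by apply: eq_bigr => i _; rewrite mxE subr0.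
  have E2 : boxvol (0 - const_mx eta) (s + const_mx eta) = \prod_i (s ord0 i + 2 * eta).
    by apply: eq_bigr => i _; rewrite !mxE; ring.
  by move: heta; rewrite E1 E2 [(1 + e) * vs]mulrDl mul1r.
have S1 : 0 < `|s| + 1 by rewrite ltr_wpDl.
have e1 : 0 < eta / (D * (`|s| + 1)) by rewrite divr_gt0 // mulr_gt0.
have [d d0 hd] := du _ e1.
exists (d / (`|s| + 1)) => [|c a' c0 cd xa]; first exact: divr_gt0.
pose A := a' - const_mx (c * eta); pose B := a' + c *: s + const_mx (c * eta).
have AB : le_rV A B.
  move=> i; rewrite !mxE; have := mulr_gt0 c0 eta0; have := mulr_gt0 c0 (s0 i); lra.
apply: (@le_trans _ _ (lebN ((fun y => y + (u x - x *m L)) @` (mulmxr L @` cbox A B)))).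
  apply: lebN_le => _ [y by_ <-].
  have yx := box_near c0 s0' xa (box_sub_cbox by_).
  (* [w] is the point that the affine map sends exactly to [u y]: the remainder [r] is pulled back
     to the domain. *)
  pose r := u y - u x - (y - x) *m L; pose w := y + r *m invmx L.
  exists (w *m L); last first.
    rewrite /w mulmxDl mulmxKV // /r mulmxBl; move: (y *m L) (x *m L) => Y X.
    by apply/rowP => i; rewrite !mxE; ring.
  exists w => // i.
  have wy : `|r *m invmx L| <= c * eta.
    apply: le_trans (hD _) _.
    have : `|r| <= eta / (D * (`|s| + 1)) * `|y - x|.
      have := hd (y - x); rewrite subrK; apply.
      apply: le_lt_trans yx _; move: cd; rewrite ltr_pdivlMr //; apply: le_lt_trans.
      by rewrite ler_pM2l // lerDl.
    move=> /(ler_wpM2l (ltW D0))/le_trans; apply.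
    have -> : D * (eta / (D * (`|s| + 1)) * `|y - x|) = eta * (`|y - x| / (`|s| + 1)).
      by field; rewrite !gt_eqF.
    rewrite [c * _]mulrC ler_pM2l // ler_pdivrMr //; apply: le_trans yx _.
    by rewrite ler_pM2l // lerDl.
  have := le_trans (ler_coord_norm _ i) wy; rewrite ler_norml.
  by have := by_ i; rewrite !mxE => /andP[h1 h2] /andP[h3 h4]; apply/andP; split; lra.
apply: le_trans (lebN_translate _ _) _; apply: le_trans (lebN_linear uL _) _.
rewrite detL mul1e; apply: le_trans (lebN_cbox_le AB) _.
rewrite lee_fin boxvol_scale boxvol_scale0 mulrCA ler_pM2l //.
exact: exprn_gt0.
Qed.

(** The image lies in a cube whose side is proportional to [c]; its volume and that of the box scale
    alike, so the factor depends only on [C] and the shape [s]. *)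
Lemma image_box_lipschitz (u : V -> V) x (C : R) (s : V) : (forall i, 0 < s ord0 i) ->
  0 <= C -> (exists2 d : R, 0 < d & forall y, `|y - x| < d -> `|u y - u x| <= C * `|y - x|) ->
  exists2 d : R, 0 < d & forall (c : R) a', 0 < c -> c < d -> cbox a' (a' + c *: s) x ->
    (lebN (u @` box a' (a' + c *: s)) <=
     ((2 * (C * `|s|)) ^+ n.+1 / \prod_i s ord0 i * boxvol a' (a' + c *: s))%:E)%E.
Proof.
move=> s0 C0 [d d0 hd].
have s0' i : 0 <= s ord0 i by exact: ltW.
have S1 : 0 < `|s| + 1 by rewrite ltr_wpDl.
exists (d / (`|s| + 1)) => [|c a' c0 cd xa]; first exact: divr_gt0.
pose A := u x - const_mx (c * (C * `|s|)); pose B := u x + c *: 0 + const_mx (c * (C * `|s|)).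
have r0 : 0 <= c * (C * `|s|) by apply: mulr_ge0; [exact: ltW|exact: mulr_ge0].
have AB : le_rV A B by move=> i; rewrite !mxE mulr0; lra.
apply: le_trans (lebN_le _) (le_trans (lebN_cbox_le AB) _).
  move=> _ [y by_ <-] i.
  have yx := box_near c0 s0' xa (box_sub_cbox by_).
  have : `|u y - u x| <= c * (C * `|s|).
    apply: le_trans (hd _ _) _.
      apply: le_lt_trans yx _; move: cd; rewrite ltr_pdivlMr //; apply: le_lt_trans.
      by rewrite ler_pM2l // lerDl.
    by rewrite mulrCA ler_wpM2l.
  move=> /(le_trans (ler_coord_norm _ i)); rewrite !mxE mulr0 ler_norml => /andP[h1 h2].
  by apply/andP; split; lra.
rewrite lee_fin boxvol_scale boxvol_scale0 [leRHS]mulrCA ler_pM2l ?exprn_gt0 //.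
rewrite divfK; last by rewrite gt_eqF // prodr_gt0.
rewrite -[X in _ <= _ ^+ X]card_ord -prodr_const le_eqVlt; apply/orP; left; apply/eqP.
by apply: eq_bigr => i _; rewrite mxE add0r.
Qed.

(** As [C] serves all points, the factor [C'] paid at points of [Z] is known before [Z] is covered,
    and the cover can be taken small enough to absorb it. *)
Lemma lebN_image_box (u : V -> V) (C : R) (Z : set V) a b : 0 <= C -> le_rV a b ->
  lebN Z = 0%E ->
  (forall x, cbox a b x -> exists2 d : R, 0 < d &
     forall y, `|y - x| < d -> `|u y - u x| <= C * `|y - x|) ->
  (forall x, cbox a b x -> ~ Z x -> exists2 L, `|\det L| = 1 & has_diff u x L) ->
  (lebN (u @` box a b) <= (boxvol a b)%:E)%E.
Proof.
move=> C0 ab Z0 hlip hdiff.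
(* The shape [s] must have positive sides; a half-open box with a side of length zero is empty. *)
have [/existsP[i /eqP abi]|/existsPn nab] := boolP [exists i, a ord0 i == b ord0 i].
  have -> : box a b = set0.
    by rewrite -subset0 => x /(_ i); rewrite abi => /andP[/le_lt_trans h /h]; rewrite ltxx.
  by rewrite image_set0 lebN_set0 lee_fin boxvol_ge0.
pose s := b - a.
have s0 i : 0 < s ord0 i by rewrite !mxE subr_gt0 lt_neqAle ab nab.
pose C' := (2 * (C * `|s|)) ^+ n.+1 / \prod_i s ord0 i.
have C'0 : 0 <= C'.
  by rewrite divr_ge0 ?exprn_ge0 ?mulr_ge0 // prodr_ge0 // => i _; exact: ltW.
apply/lee_addgt0Pr => e0 e00.
have v0 : 0 <= boxvol a b by exact: boxvol_ge0.
(* Each of the two errors, at regular points and on the cover of [Z], gets half of the tolerance. *)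
pose e := e0 / 2 / (boxvol a b + 1); pose r := e0 / 2 / (C' + 1).
have e1 : 0 < e by rewrite !divr_gt0 // ltr_wpDl.
have r1 : 0 < r by rewrite !divr_gt0 // ltr_wpDl.
have : (lebN Z < r%:E)%E by rewrite Z0 lte_fin.
move=> /lebN_open_cover[p [q [pq cov hs]]].
have ov0 a' b' k : (0 <= (overlap (p k) (q k) a' b')%:E)%E by rewrite lee_fin overlap_ge0.
pose S a' b' := (\sum_(k <oo) (overlap (p k) (q k) a' b')%:E)%E.
have S0 a' b' : (0 <= S a' b')%E by apply: nneseries_ge0.
(* The boxes [p k, q k] cover [Z]; the overlap term pays for the points where
   only the Lipschitz bound is available. *)
pose good a' b' := (lebN (u @` box a' b') <= ((1 + e) * boxvol a' b')%:E + C'%:E * S a' b')%E.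
suff : good a b.
  move=> /le_trans; apply.
  have Sr : (S a b <= r%:E)%E.
    apply: le_trans hs; apply: lee_nneseries => k *; first exact: ov0.
    by rewrite lee_fin overlap_le.
  apply: (@le_trans _ _ (((1 + e) * boxvol a b)%:E + C'%:E * r%:E)%E).
    by rewrite leeD2l // lee_wpmul2l // lee_fin.
  rewrite -EFinM -!EFinD lee_fin mulrDl mul1r -addrA lerD2l [leRHS]splitr lerD //.
    by rewrite /e mulrAC ler_pdivrMr ?ltr_wpDl // ler_wpM2l ?ltW ?divr_gt0 // ltrDl.
  by rewrite /r mulrCA ler_piMr ?ltW ?divr_gt0 // ltr_pdivrMr ?ltr_wpDl // mul1r ltrDl.
apply: (@cousin_box _ _ good) => // [a' b' i ab' g1 g2|x xab].
  set t := (a' ord0 i + b' ord0 i) / 2 in g1 g2.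
  have Scut : (S a' b' = S a' (upd b' i t) + S (upd a' i t) b')%E.
    rewrite /S -nneseriesD //; apply: eq_eseriesr => k _; rewrite -EFinD -overlap_cut //.
    by have := ab' i; rewrite /t; lra.
  apply: le_trans (@lebN_le _ _ _ (u @` box a' (upd b' i t) `|` u @` box (upd a' i t) b') _) _.
    by rewrite -image_setU; apply: image_subset; exact: box_cut.
  move: g1 g2; rewrite /good => g1 g2.
  apply: le_trans (lebN_setU _ _) _; apply: le_trans (leeD g1 g2) _.
  by rewrite Scut (boxvol_cut a' b' i t) ge0_muleDr // mulrDr EFinD addeACA.
have [Zx|nZx] := pselect (Z x); last first.
  have [L detL dL] := hdiff x xab nZx.
  have [d d0 hd] := image_box_diff s0 e1 detL dL.
  exists d => // c a' c0 cd xa; apply: le_trans (hd c a' c0 cd xa) _.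
  by rewrite leeDl // mule_ge0 // lee_fin.
have [k xk] := cov x Zx.
have [d1 d10 hd1] := small_box_sub s xk.
have [d2 d20 hd2] := image_box_lipschitz s0 C0 (hlip x xab).
exists (Num.min d1 d2) => [|c a' c0]; first by rewrite lt_min d10.
rewrite lt_min => /andP[cd1 cd2] xa.
have [pa aq] := hd1 c a' c0 cd1 xa.
have ab' : le_rV a' (a' + c *: s).
  by move=> i; have := s0 i; rewrite !mxE => h; rewrite lerDl mulr_ge0 ?ltW.
apply: le_trans (hd2 c a' c0 cd2 xa) _; rewrite -/C'.
have h1 : ((C' * boxvol a' (a' + c *: s))%:E <= C'%:E * S a' (a' + c *: s)%R)%E.
  rewrite EFinM; apply: lee_wpmul2l; first by rewrite lee_fin.
  rewrite -(overlap_sub ab' pa aq) /S (nneseriesD1 (n := k)) //.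
  by rewrite leeDl // nneseries_ge0.
apply: le_trans h1 _; rewrite leeDr // lee_fin mulr_ge0 ?boxvol_ge0 //.
by rewrite addr_ge0 // ltW.
Qed.

End ImageBox.

(** * Transport of measure and injectivity *)

Section EuclideanNorm.
Context {R : realType} {n : nat}.
Local Notation V := 'rV[R]_n.+1.
Implicit Types (x y v : V) (u : V -> V).

Lemma norm_le_eucl v : `|v| <= eucl v.
Proof.
apply: rV_norm_le => [|i]; first exact: sqrtr_ge0.
rewrite -sqrtr_sqr /eucl ler_wsqrtr // (bigD1 i) //= lerDl.
by apply: sumr_ge0 => j _; exact: sqr_ge0.
Qed.

Lemma eucl_le_norm v : eucl v <= n.+1%:R * `|v|.
Proof.
have h0 : 0 <= n.+1%:R * `|v| :> R by rewrite mulr_ge0.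
rewrite -(ger0_norm h0) -sqrtr_sqr ler_wsqrtr // exprMn.
apply: (@le_trans _ _ (\sum_(i < n.+1) `|v| ^+ 2)).
  apply: ler_sum => i _; rewrite -(real_normK (num_real (v ord0 i))).
  by rewrite lerXn2r ?nnegrE // ler_coord_norm.
rewrite sumr_const card_ord -[leLHS]mulr_natl; apply: ler_wpM2r; first exact: exprn_ge0.
by rewrite expr2 ler_peMr // ler1n.
Qed.

Lemma eucl_gt0 v : v != 0 -> 0 < eucl v.
Proof. by move=> v0; apply: lt_le_trans (norm_le_eucl v); rewrite normr_gt0. Qed.

(** The slack 1 turns the infimum over radii into one actual radius; dividing it by [n.+1] passes
    from the Euclidean ball to the max norm. *)
Lemma limsup_punct_lt (D : set V) x (q : V -> \bar R) (K : R) :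
  (limsup_punct D x q <= K%:E)%E -> exists2 d : R, 0 < d &
    forall y, D y -> y != x -> `|y - x| < d -> (q y <= (K + 1)%:E)%E.
Proof.
move=> h; have : (limsup_punct D x q < (K + 1)%:E)%E.
  by apply: le_lt_trans h _; rewrite lte_fin ltrDl.
move=> /ereal_inf_lt[_ [d /= d0 <-] hd]; exists (d / n.+1%:R); first by rewrite divr_gt0.
move=> y Dy yx yd; apply: le_trans (ltW hd); apply: ereal_sup_ubound.
exists y => //; split=> //; rewrite eucl_gt0 ?subr_eq0 //=.
by apply: le_lt_trans (eucl_le_norm _) _; rewrite mulrC -ltr_pdivlMr.
Qed.

Lemma e_u_lipschitz (X : set V) u x (K : R) : nbhs x X -> 0 <= K ->
  (e_u X u x <= K%:E)%E -> exists2 d : R, 0 < d &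
    forall y, `|y - x| < d -> `|u y - u x| <= (K + 1) * n.+1%:R * `|y - x|.
Proof.
move=> /nbhs_norm[d1 d10 hd1] K0 /limsup_punct_lt[d2 d20 hd2].
exists (Num.min d1 d2) => [|y]; first by rewrite lt_min d10.
rewrite lt_min => /andP[yd1 yd2].
have [->|yx] := eqVneq y x; first by rewrite !subrr normr0 mulr0.
have := hd2 y (hd1 y yd1) yx yd2; rewrite lee_fin ler_pdivrMr ?eucl_gt0 ?subr_eq0 // => h.
apply: le_trans (norm_le_eucl _) (le_trans h _); rewrite -mulrA ler_wpM2l ?addr_ge0 //.
exact: eucl_le_norm.
Qed.

Lemma c_u_expansive (X : set V) u x (H : R) : nbhs x X -> 0 <= H ->
  (c_u X u x <= H%:E)%E -> exists2 d : R, 0 < d &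
    forall y, `|y - x| < d -> `|y - x| <= (H + 1) * n.+1%:R * `|u y - u x|.
Proof.
move=> /nbhs_norm[d1 d10 hd1] H0 /limsup_punct_lt[d2 d20 hd2].
exists (Num.min d1 d2) => [|y]; first by rewrite lt_min d10.
rewrite lt_min => /andP[yd1 yd2].
have [->|yx] := eqVneq y x; first by rewrite !subrr normr0 mulr0.
(* If [u y = u x], the quotient is infinite, against the finite bound. *)
have := hd2 y (hd1 y yd1) yx yd2; case: eqP => // /eqP uyx.
rewrite lee_fin ler_pdivrMr ?eucl_gt0 ?subr_eq0 // => h.
apply: le_trans (norm_le_eucl _) (le_trans h _); rewrite -mulrA ler_wpM2l ?addr_ge0 //.
exact: eucl_le_norm.
Qed.

Lemma differentiable_has_diff u x : differentiable u x ->
  has_diff u x (lin1_mx ('d u x)).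
Proof.
move=> /diff_locally/eqaddoP du e /du /nbhs_norm[d d0 hd].
exists d => // h hd'; rewrite mul_rV_lin1.
have := hd h; rewrite subr0 => /(_ hd') /=.
by rewrite opprD addrA.
Qed.

End EuclideanNorm.

(** * Null overlap of images and local surjectivity *)

Section NoOverlap.
Context {R : realType} {n : nat}.
Local Notation V := 'rV[R]_n.+1.
Implicit Types (a b x y p : V) (E S : set V).

Lemma closed_borel S : closed S -> borel S.
Proof.
move=> cS; have [_ hC _] := smallest_sigma_algebra [set: V] [set O : set V | open O].
rewrite -(setCK S) -setTD; apply: hC; apply: sub_gen_smallest.
exact: closed_openC.
Qed.

Lemma closed_coord_le i (s : R) : closed [set x : V | x ord0 i <= s].
Proof.
apply: (@preimage_closed _ _ (fun x : V => x ord0 i) [set z : R | z <= s]) => [x _|].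
  exact: coord_continuous.
exact: closed_le.
Qed.

Lemma closed_coord_ge i (s : R) : closed [set x : V | s <= x ord0 i].
Proof.
apply: (@preimage_closed _ _ (fun x : V => x ord0 i) [set z : R | s <= z]) => [x _|].
  exact: coord_continuous.
exact: closed_ge.
Qed.

Definition lipschitz_at (u : V -> V) (C : R) x := exists2 d : R, 0 < d &
  forall y, `|y - x| < d -> `|u y - u x| <= C * `|y - x|.

Lemma lipschitz_at_continuous u C x : 0 <= C -> lipschitz_at u C x ->
  {for x, continuous u}.
Proof.
move=> C0 [d d0 hd]; rewrite /continuous_at => A /nbhs_norm[e e0 he].
have C1 : 0 < C + 1 by rewrite ltr_wpDl.
apply: (@norm_nbhs _ _ _ _ (Num.min d (e / (C + 1)))); first by rewrite lt_min d0 divr_gt0.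
move=> y; rewrite lt_min => /andP[yd ye]; apply: he; apply: le_lt_trans (hd y yd) _.
rewrite ltr_pdivlMr // mulrC in ye; apply: le_lt_trans ye.
by rewrite ler_wpM2r // lerDl.
Qed.

Variables (Omega Y : set V) (u : V -> V).
Hypothesis fin_Omega : (lebN Omega < +oo)%E.
Hypothesis push : pushforward_leb Omega Y u.
Hypothesis incomp : incompressible Omega u.

Definition good_ball a (r : R) := exists2 C : R, 0 <= C &
  forall x, `|x - a| <= r -> Omega x /\ lipschitz_at u C x.

Lemma clamp_contract (lo hi x y : R) : lo <= hi -> x <= y ->
  0 <= Num.min (Num.max y lo) hi - Num.min (Num.max x lo) hi <= y - x.
Proof.
move=> lohi xy.
case: (leP x lo) => h1; case: (leP y lo) => h2; rewrite ?(min_l lohi);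
  case: (leP x hi) => h3; case: (leP y hi) => h4; apply/andP; split; lra.
Qed.

(** Boxes covering [E] may leave the good ball, outside which [u] is not controlled. Clamping their
    corners to the cube does not lengthen their sides, and they still cover [E], whose points are
    strictly inside the cube. *)
Lemma lebN_image_le_domain a r E : good_ball a r -> 0 <= r ->
  (forall x, E x -> `|x - a| < r) -> (lebN (u @` E) <= lebN E)%E.
Proof.
move=> [C C0 hC] r0 Er; apply: le_ereal_inf_tmp => _ [p [q [pq [Ec ->]]]].
pose lo : V := a - const_mx r; pose hi : V := a + const_mx r.
have lohi i : lo ord0 i <= hi ord0 i by rewrite !mxE; lra.
pose cl x : V := \row_i Num.min (Num.max (x ord0 i) (lo ord0 i)) (hi ord0 i).
have cl_ge x i : lo ord0 i <= cl x ord0 i by rewrite [cl x ord0 i]mxE le_min le_max lexx orbT lohi.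
have cl_le x i : cl x ord0 i <= hi ord0 i by rewrite [cl x ord0 i]mxE ge_min lexx orbT.
have cl_mono x y i : x ord0 i <= y ord0 i ->
    0 <= cl y ord0 i - cl x ord0 i <= y ord0 i - x ord0 i.
  by move=> xy; rewrite ![cl _ ord0 i]mxE; exact: clamp_contract.
apply: le_trans (@lebN_le _ _ _ (\bigcup_k (u @` box (cl (p k)) (cl (q k)))) _) _.
  move=> _ [x Ex <-]; have [k _ bx] := Ec x Ex; exists k => //; exists x => // i.
  have := le_lt_trans (ler_coord_norm _ i) (Er x Ex).
  rewrite ![in X in X -> _]mxE ltr_norml => /andP[x1 x2].
  have xlo : lo ord0 i < x ord0 i by rewrite !mxE; lra.
  have xhi : x ord0 i < hi ord0 i by rewrite !mxE; lra.
  have /andP[h1 h2] := bx i; rewrite ![cl _ ord0 i]mxE.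
  by rewrite ge_min ge_max h1 (ltW xlo) lt_min lt_max h2 xhi.
apply: le_trans (lebN_bigcup _) _; apply: lee_nneseries => k *; first exact: lebN_ge0.
have clpq : le_rV (cl (p k)) (cl (q k)).
  by move=> i; have /andP[h _] := cl_mono _ _ i (pq k i); rewrite -subr_ge0.
have inb x : cbox (cl (p k)) (cl (q k)) x -> `|x - a| <= r.
  move=> bx; apply: rV_norm_le => // i; have /andP[h1 h2] := bx i.
  have := le_trans (cl_ge _ _) h1; have := le_trans h2 (cl_le _ _).
  by rewrite !mxE ler_norml => ? ?; apply/andP; split; lra.
apply: le_trans (lebN_image_box C0 clpq incomp _ _) _.
- by move=> x /inb/hC[].
- move=> x /inb/hC[Ox _] nZ.
  have [dx det1] : differentiable u x /\ `|\det (lin1_mx ('d u x))| = 1.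
    by apply: contrapT => h; apply: nZ; split.
  by exists (lin1_mx ('d u x)) => //; exact: differentiable_has_diff.
- by rewrite lee_fin; apply: ler_prod => i _; exact: cl_mono.
Qed.

Lemma image_compact_closed a r E : good_ball a r -> compact E ->
  (forall x, E x -> `|x - a| <= r) -> closed (u @` E).
Proof.
move=> [C C0 hC] cE Er; apply: compact_closed; first exact: norm_hausdorff.
apply: continuous_compact => //; apply: continuous_in_subspaceT => x.
rewrite inE => /Er/hC[_]; exact: lipschitz_at_continuous.
Qed.

(* The mass of the overlap of the two images is counted twice by the left-hand
   side of the transport identity and once by its right-hand side. *)
Lemma no_overlap a b r1 r2 (E1 E2 : set V) i (s t : R) : 0 <= r1 -> 0 <= r2 ->
  good_ball a r1 -> good_ball b r2 -> compact E1 -> compact E2 ->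
  (forall x, E1 x -> `|x - a| < r1) -> (forall x, E2 x -> `|x - b| < r2) ->
  s < t -> (forall x, E1 x -> x ord0 i <= s) -> (forall x, E2 x -> t <= x ord0 i) ->
  lebN (u @` E1 `&` u @` E2) = 0%E.
Proof.
move=> r10 r20 g1 g2 c1 c2 E1r E2r st E1s E2t.
set S := u @` E1 `&` u @` E2.
pose F1 := E1 `&` u @^-1` S; pose F2 := E2 `&` u @^-1` S.
have S1 : (lebN S <= lebN F1)%E.
  apply: le_trans (lebN_image_le_domain g1 r10 (E := F1) _); last by move=> x [/E1r].
  by apply: lebN_le => y Sy; have [[x E1x xy] _] := Sy; exists x => //; split=> //=; rewrite xy.
have S2 : (lebN S <= lebN F2)%E.
  apply: le_trans (lebN_image_le_domain g2 r20 (E := F2) _); last by move=> x [/E2r].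
  by apply: lebN_le => y Sy; have [_ [x E2x xy]] := Sy; exists x => //; split=> //=; rewrite xy.
have O1 : E1 `<=` Omega.
  by move=> x /E1r/ltW xr; have [C _ hC] := g1; have [] := hC x xr.
have O2 : E2 `<=` Omega.
  by move=> x /E2r/ltW xr; have [C _ hC] := g2; have [] := hC x xr.
have bS : borel S.
  apply: closed_borel; apply: closedI.
    by apply: (image_compact_closed g1) => // x /E1r/ltW.
  by apply: (image_compact_closed g2) => // x /E2r/ltW.
have F12 : (lebN F1 + lebN F2 <= lebN S)%E.
  apply: (@le_trans _ _ (lebN (Omega `&` u @^-1` S))); last first.
    by rewrite (push bS); apply: lebN_le => x [].
  apply: le_trans (lebN_halfspace _ i t).
  apply: leeD; apply: lebN_le => x [Ex Sx]; split=> //=.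
  - by split=> //; exact: O1.
  - by apply: le_lt_trans st; exact: E1s.
  - by split=> //; exact: O2.
  - exact: E2t.
(* Finiteness allows [lebN F1] to be cancelled between [F12] and [S1], which leaves [lebN F2]
   null. *)
have fF1 : lebN F1 \is a fin_num.
  rewrite ge0_fin_numE ?lebN_ge0 //; apply: le_lt_trans fin_Omega.
  by apply: lebN_le => x [/O1].
apply/le_anti; rewrite lebN_ge0 andbT; apply: le_trans S2 _.
by have := le_trans F12 S1; rewrite -[leRHS]adde0 leeD2lE.
Qed.

(* Almost every point has no twin in the ball, so some point near the centre is
   regular and without twin; the degree at its image, hence on the whole ball
   around [u a], is then nonzero. *)
Lemma image_covers a (r G : R) : 0 < r -> 0 < G -> good_ball a (2 * r) ->
  (forall x, `|x - a| <= r -> `|x - a| <= G * `|u x - u a|) ->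
  exists2 rho : R, 0 < rho &
    forall q, `|q - u a| < rho -> exists2 x, `|x - a| <= r & u x = q.
Proof.
move=> r0 G0 gb expa; pose rho := r / G.
have rho0 : 0 < rho by exact: divr_gt0.
exists rho => //.
have [C C0 hC] := gb.
(* [no_overlap] wants its compact sets in the open good ball, hence the radius [2 * r] for a closed
   ball of radius [r]. *)
have r2 x : `|x - a| <= r -> `|x - a| < 2 * r by lra.
have inO x : `|x - a| <= r -> Omega x by move=> /r2/ltW/hC[].
have cu x : `|x - a| <= r -> {for x, continuous u}.
  by move=> /r2/ltW/hC[_]; exact: lipschitz_at_continuous.
have bd x : `|x - a| = r -> rho <= `|u x - u a|.
  by move=> xr; rewrite /rho ler_pdivrMr // mulrC -xr; apply: expa; rewrite xr.
pose B : set V := [set x | `|x - a| <= r].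
have cB : compact B by exact: closed_cube_compact.
(* Two points with the same image differ in some coordinate, and two rationals fit between its
   values; so these countably many sets contain every value taken twice on [B]. *)
pose S (k : 'I_n.+1 * (rat * rat)) :=
  if (k.2.1 < k.2.2)%R then u @` (B `&` [set x | x ord0 k.1 <= ratr k.2.1])
    `&` u @` (B `&` [set x | ratr k.2.2 <= x ord0 k.1]) else set0.
have S0 k : lebN (Omega `&` u @^-1` S k) = 0%E.
  case: k => i [s t]; rewrite /S /=; case: ifP => [st|_]; last first.
    by rewrite preimage_set0 setI0 lebN_set0.
  have cs : compact (B `&` [set x | x ord0 i <= ratr s]).
    by apply: compact_closedI => //; exact: closed_coord_le.
  have ct : compact (B `&` [set x | ratr t <= x ord0 i]).
    by apply: compact_closedI => //; exact: closed_coord_ge.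
  have h2 : 0 <= 2 * r by lra.
  (* Transport carries nullity from the set of values back to the set of points. *)
  rewrite push; last first.
    apply: closed_borel; apply: closedI.
      by apply: (image_compact_closed gb) => // x [/r2/ltW].
    by apply: (image_compact_closed gb) => // x [/r2/ltW].
  apply/le_anti; rewrite lebN_ge0 andbT.
  rewrite -(@no_overlap a a (2 * r) (2 * r) _ _ i (ratr s) (ratr t) h2 h2 gb gb cs ct).
  - by apply: lebN_le => x [].
  - by move=> x [/r2].
  - by move=> x [/r2].
  - by rewrite ltr_rat.
  - by move=> x [].
  - by move=> x [].
pose Z := [set x | Omega x /\ ~ (differentiable u x /\ `|\det (lin1_mx ('d u x))| = 1)].
pose D := \bigcup_k (Omega `&` u @^-1` S k).
have ZD : lebN (Z `|` D) = 0%E.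
  apply/le_anti; rewrite lebN_ge0 andbT; apply: le_trans (lebN_setU _ _) _.
  by rewrite [lebN Z]incomp [lebN D]lebN_bigcup0 // adde0.
have [d d0 hd] : exists2 d : R, 0 < d & forall x, `|x - a| < d -> `|u x - u a| < rho.
  have a0 : `|a - a| <= r by rewrite subrr normr0 ltW.
  have rhob : nbhs (u a) [set y | `|y - u a| < rho] by exact: norm_nbhs rho0 _.
  by have /nbhs_norm := cu a a0 _ rhob.
pose e := Num.min d r / 2.
have m0 : 0 < Num.min d r by rewrite lt_min d0.
have e0 : 0 < e by exact: divr_gt0.
have [x0 [x0e nZD]] : exists x0, cbox (a - const_mx e) (a + const_mx e) x0 /\ ~ (Z `|` D) x0.
  apply: contrapT => h.
  have ab : le_rV (a - const_mx e) (a + const_mx e) by move=> i; rewrite !mxE; lra.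
  have := lebN_cbox_ge ab; apply/negP; rewrite -ltNge.
  apply: (@le_lt_trans _ _ (lebN (Z `|` D))).
    by apply: lebN_le => x xe; apply: contrapT => nx; apply: h; exists x.
  rewrite ZD lte_fin; apply: prodr_gt0 => i _; rewrite !mxE; lra.
have x0a : `|x0 - a| < Num.min d r.
  apply: (@le_lt_trans _ _ e); last by rewrite /e ltr_pdivrMr // mulr_natr mulr2n ltrDl.
  apply: rV_norm_le => [|i]; first exact: ltW.
  by have := x0e i; rewrite !mxE ler_norml => /andP[h1 h2]; apply/andP; split; lra.
move: x0a; rewrite lt_min => /andP[x0d x0r].
have Ox0 := inO _ (ltW x0r).
have [dx det1] : differentiable u x0 /\ `|\det (lin1_mx ('d u x0))| = 1.
  by apply: contrapT => h; apply: nZD; left; split.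
apply: (@image_covers_ball R n u a (u a) x0 r rho (lin1_mx ('d u x0))) => //.
- exact: hd.
- move=> x xr ux; apply: contrapT => xx0; apply: nZD; right.
  have /rV_norm_attained[i hi] : 0 < `|x - x0| by rewrite normr_gt0 subr_eq0; apply/eqP.
  have sep (y z : V) : y ord0 i < z ord0 i -> B y -> B z -> u y = u x0 -> u z = u x0 -> D x0.
    move=> yz By Bz uy uz.
    have /rat_in_itvoo[t] := yz; rewrite in_itv /= => /andP[yt tz].
    have /rat_in_itvoo[s] := yt; rewrite in_itv /= => /andP[ys st].
    exists (i, (s, t)) => //; split=> //; rewrite /S /= -(ltr_rat R) st.
    by split; [exists y|exists z] => //; split=> //; exact: ltW.
  have : x ord0 i != x0 ord0 i.
    apply/eqP => h; move: hi; rewrite !mxE h subrr normr0 => /esym/eqP.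
    by rewrite normr_eq0 subr_eq0 => /eqP.
  rewrite neq_lt => /orP[h|h].
    by apply: (sep x x0) => //; exact: ltW.
  by apply: (sep x0 x) => //; exact: ltW.
- by rewrite unitmxE unitfE -normr_gt0 det1.
- exact: differentiable_has_diff.
Qed.

End NoOverlap.

Theorem theorem2p13 (R : realType) (N : nat)
  (Omega Y : set 'rV[R]_N) (A : set (set 'rV[R]_N))
  (H K : 'rV[R]_N -> R) (u : 'rV[R]_N -> 'rV[R]_N) :
  Omega !=set0 -> open Omega -> bounded_set Omega -> connected Omega ->
  lebN Omega = 1%E ->
  open Y -> lebN Y = 1%E ->
  (forall x, closure Omega x -> 0 < H x) ->
  (forall x, closure Omega x -> 0 < K x) ->
  L1_mu Omega H -> L1_mu Omega K ->
  ball_family_covering A (closure Omega) ->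
  Refo Omega Y A H K u ->
  incompressible Omega u ->
  forall x y, Omega x -> Omega y -> u x = u y -> x = y.
Proof.
case: N Omega Y A H K u => [|n] Omega Y A H K u.
  by move=> *; apply/rowP => -[].
move=> _ oO _ _ vO _ _ H0 K0 _ _ _ [_ [push refo]] incomp.
have nb x : Omega x -> nbhs x (closure Omega).
  by move=> Ox; apply: filterS (@subset_closure _ _) _; exact: open_nbhs_nbhs.
have loc a : Omega a -> exists r G : R, [/\ 0 < r, 0 < G, good_ball Omega u a r &
    forall x, `|x - a| <= r -> `|x - a| <= G * `|u x - u a|].
  move=> Oa; have cOa := subset_closure Oa.
  have [r1 [r10 [_ hr1]]] := refo a cOa.
  have /nbhs_norm[r2 r20 hr2] : nbhs a Omega by exact: open_nbhs_nbhs.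
  have inb y : `|y - a| <= r1 / n.+1%:R -> ecball a r1 y.
    move=> ya; apply: le_trans (eucl_le_norm _) _.
    by rewrite mulrC -ler_pdivlMr.
  have r1n : 0 < r1 / n.+1%:R by rewrite divr_gt0.
  have aa : ecball a r1 a by apply: inb; rewrite subrr normr0 ltW.
  have [ca _] := hr1 a aa Oa.
  have [r3 r30 hr3] := c_u_expansive (nb a Oa) (ltW (H0 a cOa)) ca.
  pose m := Num.min (r1 / n.+1%:R) (Num.min r2 r3).
  have m0 : 0 < m by rewrite !lt_min r1n r20.
  have m2 : m / 2 < m by rewrite ltr_pdivrMr // mulr_natr mulr2n ltrDl.
  exists (m / 2), ((H a + 1) * n.+1%:R); split.
  - exact: divr_gt0.
  - by rewrite mulr_gt0 // addr_gt0 // H0.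
  (* [Refo] bounds [e_u] throughout the ball by [K] at the centre, whence one constant for all
     [x]. *)
  - exists ((K a + 1) * n.+1%:R).
      by rewrite mulr_ge0 // addr_ge0 // ltW // K0.
    move=> x /le_lt_trans/(_ m2); rewrite !lt_min => /and3P[/ltW x1 x2 x3].
    have Ox := hr2 x x2; split=> //.
    have [_ ex] := hr1 x (inb x x1) Ox.
    exact: e_u_lipschitz (nb x Ox) (ltW (K0 a cOa)) ex.
  - by move=> x /le_lt_trans/(_ m2); rewrite !lt_min => /and3P[_ _]; exact: hr3.
have fO : (lebN Omega < +oo)%E by rewrite vO ltry.
(* Distinct points differ in some coordinate, so up to exchanging them this is the general case;
   coordinate [i] also supplies the separating hyperplane. *)
have key (a b : 'rV[R]_n.+1) i : Omega a -> Omega b -> u a = u b -> a ord0 i < b ord0 i -> False.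
  move=> Oa Ob uab abi.
  have [ra [Ga [ra0 Ga0 gra ea]]] := loc a Oa.
  have [rb [Gb [rb0 Gb0 grb eb]]] := loc b Ob.
  pose m := Num.min (Num.min ra rb) (b ord0 i - a ord0 i).
  have m0 : 0 < m by rewrite !lt_min ra0 rb0 subr_gt0.
  have mra : m <= ra by rewrite /m !ge_min lexx.
  have mrb : m <= rb by rewrite /m !ge_min lexx orbT.
  have mab : m <= b ord0 i - a ord0 i by rewrite /m ge_min lexx orbT.
  (* A quarter keeps the doubled balls good and puts [a ord0 i + r] strictly below
     [b ord0 i - r]. *)
  pose r := m / 4.
  have r0 : 0 < r by rewrite divr_gt0.
  have r4 : 4 * r = m by rewrite mulrC divfK.
  clearbody r m.
  have shrink c rc : 2 * r <= rc -> good_ball Omega u c rc -> good_ball Omega u c (2 * r).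
    by move=> hc [C C0 hC]; exists C => // x xr; apply: hC; exact: le_trans hc.
  have ga : good_ball Omega u a (2 * r) by apply: shrink gra; lra.
  have gb : good_ball Omega u b (2 * r) by apply: shrink grb; lra.
  have [ra' rb'] : r <= ra /\ r <= rb by split; lra.
  have [rho1 rho10 cov1] := image_covers fO push incomp r0 Ga0 ga
    (fun x xr => ea x (le_trans xr ra')).
  have [rho2 rho20 cov2] := image_covers fO push incomp r0 Gb0 gb
    (fun x xr => eb x (le_trans xr rb')).
  pose e := Num.min rho1 rho2 / 2.
  have mr0 : 0 < Num.min rho1 rho2 by rewrite lt_min rho10.
  have e0 : 0 < e by exact: divr_gt0.
  have em : e < Num.min rho1 rho2 by rewrite ltr_pdivrMr // mulr_natr mulr2n ltrDl.
  have pe : le_rV (u a - const_mx e) (u a + const_mx e) by move=> j; rewrite !mxE; lra.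
  have r20 : 0 <= 2 * r by lra.
  have abr : a ord0 i + r < b ord0 i - r by lra.
  have := @no_overlap _ _ _ _ _ fO push incomp a b _ _ _ _ i _ _ r20 r20 ga gb
    (@closed_cube_compact _ _ a r) (@closed_cube_compact _ _ b r) _ _ abr.
  move=> /(_ _ _ _ _)/wrap[].
  - by move=> x /= xr; lra.
  - by move=> x /= xr; lra.
  - move=> x /= /(le_trans (ler_coord_norm _ i)); rewrite !mxE ler_norml => /andP[_].
    by lra.
  - move=> x /= /(le_trans (ler_coord_norm _ i)); rewrite !mxE ler_norml => /andP[+ _].
    by lra.
  (* The cube of half-side [e] about the common value lies in both images, and its positive volume
     contradicts their null overlap. *)
  move=> S0; have := lebN_cbox_ge pe; apply/negP; rewrite -ltNge.
  apply: (@le_lt_trans _ _ 0%E); last first.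
    by rewrite lte_fin; apply: prodr_gt0 => j _; rewrite !mxE; lra.
  rewrite -S0; apply: lebN_le => q qe.
  have : `|q - u a| < Num.min rho1 rho2.
    apply: le_lt_trans em; apply: rV_norm_le => [|j]; first exact: ltW.
    by have := qe j; rewrite !mxE ler_norml => /andP[h1 h2]; apply/andP; split; lra.
  rewrite lt_min => /andP[q1 q2]; split.
    by have [x xr <-] := cov1 q q1; exists x.
  by rewrite uab in q2; have [x xr <-] := cov2 q q2; exists x.
move=> x y Ox Oy uxy; apply/rowP => i; apply/eqP.
have [h|h|//] := ltgtP (x ord0 i) (y ord0 i).
- by case: (key x y i Ox Oy uxy h).
- by case: (key y x i Oy Ox (esym uxy) h).
Qed.
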